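(* For $q>0$, the equivalence (conjugacy) classes of standard Cartan subsets of $G$ relative to $C$ can be represented by: (1) $C$; (2) $\exp(\mathbb R(F_{0,1}+F_{d,d+1})\oplus\mathbb R(F_{0,d}-F_{1,d+1}))$; (3) $\exp(\mathbb R(F_{0,1}+F_{d,d+1})\oplus\mathbb R(F_{0,d}-F_{1,d+1}))\,t_{0,\pi}$; (4) $\exp(\mathbb RF_{0,1}\oplus\mathbb RF_{2,d+1})$; (5) $\exp(\mathbb RF_{d,d+1}\oplus\mathbb RF_{0,d-1})$ (this one does not exist for $q=1$); (6) $\exp(\mathbb RF_{0,d}\oplus\mathbb RF_{1,d+1})$; (7) $\exp(\mathbb RF_{0,d}\oplus\mathbb RF_{1,d+1})\,t_{\pi/2,\pi/2}$; (8) $\exp(\mathbb RF_{0,d}\oplus\mathbb RF_{1,d+1})\,t_{0,\pi}$.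
   Context: Let $p\ge q$ be natural numbers with $d=p+q>2$ (here $q>0$), and let $\eta=\operatorname{diag}(1^{p+1},(-1)^{q+1})$ on $\mathbb R^{d+2}$ with standard basis $e_0,\dots,e_{d+1}$. $G=SO(p+1,q+1)_0$, $K=SO(p+1)\times SO(q+1)$, $\mathfrak g=\mathfrak{so}(p+1,q+1)$, $\theta(X)=-X^T$ with $\pm1$-eigenspaces $\mathfrak k,\mathfrak p$, $B(X,Y)=\operatorname{tr}(XY)$. $F_{\mu\nu}\in\mathfrak g$ is given by $F_{\mu\nu}e_\rho=\eta_{\nu\rho}e_\mu-\eta_{\mu\rho}e_\nu$ ($0\le\mu,\nu\le d+1$). $\sigma$ is conjugation by $\operatorname{diag}(-1,1,\dots,1,-1)$, and $H=MA$ is the centraliser in $G$ of $D_0=-F_{0,d+1}$ (so $(G^\sigma)_0\le H\le G^\sigma$). $V^{\pm\sigma}$ denote the $\pm1$-eigenspaces of $\sigma$ on $V$. The fixed fundamental Cartan subset is $C=\exp(\mathfrak c)$ with $\mathfrak c=\mathfrak t=\operatorname{span}\{F_{0,1},F_{d,d+1}\}$, $\mathfrak a=0$; $T=\exp(\mathfrak t)$ consists of the elements $t_{\phi,\psi}=\exp(\phi F_{0,1}+\psi F_{d,d+1})$. A standard Cartan subset (relative to $C$) is $C'=\exp(\mathfrak c')t\subseteq G$ with $t\in T$, $\mathfrak c'\le\mathfrak g^{-\sigma}\cap\operatorname{Ad}(t)(\mathfrak g^{-\sigma})$ a commutative subalgebra, $\mathfrak c'=\mathfrak t'\oplus\mathfrak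 a'$ with $\mathfrak t'\le\mathfrak t$, $\mathfrak a\le\mathfrak a'\subseteq\mathfrak p$, and $\dim\mathfrak c'=\dim\mathfrak c$; put $T'=\exp(\mathfrak t')t$, so $C'=\exp(\mathfrak a')T'$. Two standard Cartan subsets $\exp(\mathfrak a_1')T_1'$ and $\exp(\mathfrak a_2')T_2'$ are conjugate (equivalent) if there are $h,h'\in K\cap H$ with $hT_1'h'^{-1}=T_2'$. *)

(* Defs.v *)
From HB Require Import structures.
From mathcomp Require Import all_boot all_order all_algebra.
From mathcomp Require Import all_classical all_reals all_analysis.
Set Implicit Arguments.
Unset Strict Implicit.
Unset Printing Implicit Defensive.
Import Order.TTheory GRing.Theory Num.Theory.
Import numFieldNormedType.Exports.
Local Open Scope classical_set_scope.
Local Open Scope ring_scope.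

(* The limit exists for every X, so it is not a default value of limn. *)
Definition expmx (R : realType) (n : nat) (X : 'M[R]_n) : 'M[R]_n :=
  limn (series (fun k : nat => (k`!%:R)^-1 *: X ^+ k)).

(* Ad g X, and also the group conjugation x |-> g x g^-1. *)
Definition Admx (R : realType) (n : nat) (g X : 'M[R]_n) : 'M[R]_n :=
  g *m X *m invmx g.

Definition special_orthogonal (R : realType) (n : nat) : set 'M[R]_n :=
  [set g | g^T *m g = 1%:M /\ \det g = 1].

(* R^(d+2) with d = p + q is R^(p.+1 + q.+1): the p+1 positive basis vectors
   e_0, .., e_p come first, then the q+1 negative ones e_(p+1), .., e_(d+1). *)
Notation Mpq R p q := 'M[R]_(p.+1 + q.+1).

Definition etamx (R : realType) (p q : nat) : Mpq R p q :=
  block_mx 1%:M 0 0 (- 1%:M).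

Definition SOpq (R : realType) (p q : nat) : set (Mpq R p q) :=
  [set g | g^T *m etamx R p q *m g = etamx R p q /\ \det g = 1].

Definition Ggrp (R : realType) (p q : nat) : set (Mpq R p q) :=
  connected_component (@SOpq R p q) 1%:M.

Definition Kgrp (R : realType) (p q : nat) : set (Mpq R p q) :=
  [set g | exists (A : 'M[R]_p.+1) (B : 'M[R]_q.+1),
     [/\ special_orthogonal A, special_orthogonal B & g = block_mx A 0 0 B]].

Definition galg (R : realType) (p q : nat) : set (Mpq R p q) :=
  [set X | X^T *m etamx R p q + etamx R p q *m X = 0].

Definition theta (R : realType) (n : nat) (X : 'M[R]_n) : 'M[R]_n := - X^T.

Definition palg (R : realType) (p q : nat) : set (Mpq R p q) :=
  [set X | galg X /\ theta X = - X].

(* Column rho of Fgen mu nu is eta_(nu,rho) e_mu - eta_(mu,rho) e_nu. *)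
Definition Fgen (R : realType) (p q : nat) (mu nu : 'I_(p.+1 + q.+1)) :
    Mpq R p q :=
  \matrix_(i, rho) (etamx R p q nu rho * (i == mu)%:R
                    - etamx R p q mu rho * (i == nu)%:R).

Lemma FgenE (R : realType) (p q : nat) (mu nu rho : 'I_(p.+1 + q.+1)) :
  Fgen R mu nu *m delta_mx rho (0 : 'I_1) =
  etamx R p q nu rho *: delta_mx mu 0 - etamx R p q mu rho *: delta_mx nu 0.
Proof.
apply/matrixP => i j; rewrite !mxE (bigD1 rho) //= big1 ?addr0; last first.
  by move=> k kr; rewrite [X in _ * X]mxE (negPf kr) /= mulr0.
by rewrite [X in _ * X]mxE !mxE !eqxx !ord1 !eqxx !andbT mulr1.
Qed.

(* inord preserves the value of every index mu <= d + 1; no others are used. *)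
Definition eidx (p q mu : nat) : 'I_(p.+1 + q.+1) := @inord (p + q.+1) mu.

Definition Fmx (R : realType) (p q mu nu : nat) : Mpq R p q :=
  Fgen R (eidx p q mu) (eidx p q nu).

Definition sigma_mx (R : realType) (p q : nat) : Mpq R p q :=
  diag_mx (\row_i (if (i == 0%N :> nat) || (i == (p + q).+1 :> nat)
                   then -1 else 1)).

Definition sigma_conj (R : realType) (p q : nat) (X : Mpq R p q) : Mpq R p q :=
  Admx (sigma_mx R p q) X.

Definition gminus (R : realType) (p q : nat) : set (Mpq R p q) :=
  [set X | galg X /\ sigma_conj X = - X].

Definition D0 (R : realType) (p q : nat) : Mpq R p q :=
  - Fmx R p q 0 (p + q).+1.

Definition Hgrp (R : realType) (p q : nat) : set (Mpq R p q) :=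
  [set g | Ggrp g /\ g *m D0 R p q = D0 R p q *m g].

Definition talg (R : realType) (p q : nat) : {vspace Mpq R p q} :=
  (<[Fmx R p q 0 1]> + <[Fmx R p q (p + q) (p + q).+1]>)%VS.

Definition aalg (R : realType) (p q : nat) : {vspace Mpq R p q} := 0%VS.

Definition calg (R : realType) (p q : nat) : {vspace Mpq R p q} :=
  (talg R p q + aalg R p q)%VS.

(* The set exp(V) t. *)
Definition exp_coset (R : realType) (n : nat) (V : {vspace 'M[R]_n})
    (t : 'M[R]_n) : set 'M[R]_n :=
  [set expmx X *m t | X in [set X | X \in V]].

Definition Tgrp (R : realType) (p q : nat) : set (Mpq R p q) :=
  exp_coset (talg R p q) 1%:M.

Definition tmx (R : realType) (p q : nat) (phi psi : R) : Mpq R p q :=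
  expmx (phi *: Fmx R p q 0 1 + psi *: Fmx R p q (p + q) (p + q).+1).

Record standard_cartan_data (R : realType) (p q : nat) (t : Mpq R p q)
    (c' t' a' : {vspace Mpq R p q}) : Prop := StandardCartanData {
  scd_T : Tgrp t;
  scd_gminus : forall X, X \in c' -> gminus X;
  scd_Ad_gminus : forall X, X \in c' -> (Admx t @` @gminus R p q) X;
  scd_comm : forall X Y, X \in c' -> Y \in c' -> X *m Y = Y *m X;
  scd_sum : c' = (t' + a')%VS;
  scd_direct : (t' :&: a' = 0)%VS;
  scd_t' : (t' <= talg R p q)%VS;
  scd_a : (aalg R p q <= a')%VS;
  scd_p : forall X, X \in a' -> palg X;
  scd_dim : \dim c' = \dim (calg R p q) }.

(* C' is a standard Cartan subset with compact part T'. *)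
Definition standard_cartan_pair (R : realType) (p q : nat)
    (C' T' : set (Mpq R p q)) : Prop :=
  exists t c' t' a', [/\ standard_cartan_data t c' t' a',
    C' = exp_coset c' t & T' = exp_coset t' t].

Definition standard_cartan (R : realType) (p q : nat)
    (C' : set (Mpq R p q)) : Prop :=
  exists T', standard_cartan_pair C' T'.

(* The sets T1 and T2 are determined by C1 and C2: T' = C' `&` K. *)
Definition cartan_conj (R : realType) (p q : nat)
    (C1 C2 : set (Mpq R p q)) : Prop :=
  exists T1 T2,
    [/\ standard_cartan_pair C1 T1, standard_cartan_pair C2 T2 &
        exists h h', [/\ (@Kgrp R p q `&` @Hgrp R p q) h,
                         (@Kgrp R p q `&` @Hgrp R p q) h' &
                         [set h *m x *m invmx h' | x in T1] = T2]].

Inductive cartan_label : Type :=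
  Rep1 | Rep2 | Rep3 | Rep4 | Rep5 | Rep6 | Rep7 | Rep8.

Definition cartan_rep (R : realType) (p q : nat) (l : cartan_label) :
    set (Mpq R p q) :=
  let d := (p + q)%N in
  let diag01 := Fmx R p q 0 1 + Fmx R p q d d.+1 in
  let anti01 := Fmx R p q 0 d - Fmx R p q 1 d.+1 in
  let noncompact := (<[Fmx R p q 0 d]> + <[Fmx R p q 1 d.+1]>)%VS in
  match l with
  | Rep1 => exp_coset (calg R p q) 1%:M
  | Rep2 => exp_coset (<[diag01]> + <[anti01]>)%VS 1%:M
  | Rep3 => exp_coset (<[diag01]> + <[anti01]>)%VS (tmx p q 0 pi)
  | Rep4 => exp_coset (<[Fmx R p q 0 1]> + <[Fmx R p q 2 d.+1]>)%VS 1%:M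
  | Rep5 => exp_coset (<[Fmx R p q d d.+1]> + <[Fmx R p q 0 d.-1]>)%VS 1%:M
  | Rep6 => exp_coset noncompact 1%:M
  | Rep7 => exp_coset noncompact (tmx p q (pi / 2) (pi / 2))
  | Rep8 => exp_coset noncompact (tmx p q 0 pi)
  end.

Arguments cartan_rep R p q l : clear implicits.

(* The fifth class does not exist for q = 1. *)
Definition cartan_label_ok (q : nat) (l : cartan_label) : Prop :=
  if l is Rep5 then q <> 1%N else True.

(* Main.v *)
Require Import Defs.
From HB Require Import structures.
From mathcomp Require Import all_boot all_order all_algebra.
From mathcomp Require Import all_classical all_reals all_analysis.
From mathcomp Require Import zify ring lra.
Import Order.TTheory GRing.Theory Num.Theory.
Import numFieldNormedType.Exports.
Set Implicit Arguments.
Unset Strict Implicit.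
Unset Printing Implicit Defensive.
Local Open Scope classical_set_scope.
Local Open Scope ring_scope.

(** Conjugation by sigma inverts T, so an element of g^(-sigma) lies in
    Ad(t) g^(-sigma) exactly when it commutes with t^2; a standard Cartan subset
    is thus a pair t', a' of total dimension 2 with a' in p, commuting with t'
    and t^2. If dim t' = 2 the subset is C. If dim t' = 1, the entries of a
    generator of a' decide between a coordinate line (classes 4 and 5) and the
    diagonal or antidiagonal line of t (classes 2 and 3, the antidiagonal being
    conjugate to the diagonal). If t' = 0, t^2 is trivial or is -1 on both planes
    of T, which leaves classes 6, 7 and 8. The conjugations needed are by
    diagonal sign matrices in K and H.

    Conversely T' is the set of orthogonal elements of C', because an orthogonal
    exponential of a symmetric matrix is trivial. Elements of K and H are +1 or
    -1 on e_0 and e_(d+1) simultaneously, so the two corner entries of the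
    elements of T' are invariant up to a common sign, and they separate the
    eight classes. *)

(** * The matrix exponential *)

(** Conjugacy compares only the compact parts [T'], so [a'] is never brought to a normal form: it
    matters only through the equations that it forces on [t'] and on the square of [t], and these
    are read off single matrix entries. The square of [t] determines its angles only up to multiples
    of pi. The two factors [h] and [h'] of a conjugation are independent, so multiplication by
    [trot pi pi] on one side is allowed; together with the reversal of one angle it identifies the
    remaining solutions, except for a relative sign. That sign is what distinguishes class 2 from 3
    and class 6 from 8, and it survives because an element of K and H cannot change the signs of e_0
    and e_(d+1) independently. On T the exponential has a closed form, but an element of C' is the
    exponential of a sum of a compact and a symmetric part. Splitting it requires the addition
    formula for arbitrary commuting matrices, which is the main analytic input. *)

Lemma eq_range (S T : Type) (F F' : S -> T) : F =1 F' -> range F = range F'.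
Proof. by move=> /funext->. Qed.

Lemma cvg_mx (R : realType) (T : Type) (F : set_system T) (FF : Filter F)
    (m n : nat) (f : T -> 'M[R]_(m, n)) (L : 'M[R]_(m, n)) :
  (forall i j, (fun x => f x i j) @ F --> L i j) -> f @ F --> L.
Proof.
move=> fL A [P PL PA].
have : \forall x \near F, forall i, forall j, P i j (f x i j).
  apply: filter_forall => i; apply: filter_forall => j.
  exact: (fL i j _ (PL i j)).
by apply: filterS => x Px; exact: PA.
Qed.

Lemma series_mxE (R : realType) (m n : nat) (f : nat -> 'M[R]_(m, n)) N i j :
  series f N i j = series (fun k => f k i j) N.
Proof. by rewrite /series /= summxE. Qed.

Definition expcoef (R : realType) (n : nat) (X : 'M[R]_n) (k : nat) : 'M[R]_n :=
  (k`!%:R)^-1 *: X ^+ k.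

Lemma expmx_lim (R : realType) (n : nat) (X L : 'M[R]_n) :
  (forall i j, series (fun k => expcoef X k i j) @ \oo --> L i j) ->
  expmx X = L.
Proof.
move=> XL; apply/cvg_lim; first exact: norm_hausdorff.
apply: cvg_mx => i j; under eq_fun do rewrite series_mxE.
exact: XL.
Qed.

(** Summing over all entries dominates every row sum, so multiplying by [X] enlarges a uniform bound
    on entries by at most this factor; the dimension never appears in the estimates. *)
Definition mx1norm (R : realType) (n : nat) (X : 'M[R]_n) : R :=
  \sum_i \sum_j `|X i j|.

Lemma mx1norm_ge0 (R : realType) (n : nat) (X : 'M[R]_n) : 0 <= mx1norm X.
Proof. by apply: sumr_ge0 => i _; apply: sumr_ge0. Qed.

Lemma normr_mulmx_le (R : realType) (n : nat) (X M : 'M[R]_n) (b : R) :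
  0 <= b -> (forall i j, `|M i j| <= b) ->
  forall i j, `|(X *m M) i j| <= mx1norm X * b.
Proof.
move=> b0 Mb i j; rewrite mxE; apply: le_trans (ler_norm_sum _ _ _) _.
apply: (@le_trans _ _ (\sum_k `|X i k| * b)).
  by apply: ler_sum => k _; rewrite normrM ler_wpM2l.
rewrite -mulr_suml ler_wpM2r // /mx1norm [leRHS](bigD1 i) //= lerDl.
by apply: sumr_ge0 => k _; apply: sumr_ge0.
Qed.

Lemma exprmxS (R : realType) (n : nat) (X : 'M[R]_n) k :
  X ^+ k.+1 = X *m X ^+ k.
Proof. by rewrite exprS. Qed.

Lemma normr_exprmx_le (R : realType) (n : nat) (X : 'M[R]_n) k i j :
  `|(X ^+ k) i j| <= mx1norm X ^+ k.
Proof.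
elim: k i j => [|k IH] i j.
  by rewrite !expr0 mxE; case: (i == j); rewrite ?normr1 ?normr0.
rewrite exprmxS exprS; apply: normr_mulmx_le => //.
by rewrite exprn_ge0 // mx1norm_ge0.
Qed.

(** Comparison, entry by entry, with the scalar exponential series at [mx1norm X]. *)
Lemma is_cvg_expmx_entry (R : realType) (n : nat) (X : 'M[R]_n) i j :
  cvgn (series (fun k => expcoef X k i j)).
Proof.
apply: normed_cvg; apply: series_le_cvg (is_cvg_series_exp_coeff (mx1norm X)).
- by move=> k; rewrite normr_ge0.
- by move=> k; rewrite exp_coeff_ge0 // mx1norm_ge0.
move=> k; rewrite /exp_coeff /= /expcoef mxE normrM mulrC.
rewrite [X in _ * X]ger0_norm ?invr_ge0 // ler_wpM2r ?invr_ge0 //.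
exact: normr_exprmx_le.
Qed.

Lemma expmxE (R : realType) (n : nat) (X : 'M[R]_n) i j :
  expmx X i j = limn (series (fun k => expcoef X k i j)).
Proof.
rewrite (@expmx_lim _ _ _ (\matrix_(i, j) limn (series (fun k => expcoef X k i j)))).
  by rewrite mxE.
by move=> {}i {}j; rewrite mxE; exact: is_cvg_expmx_entry.
Qed.

Lemma cvg_expmx (R : realType) (n : nat) (X : 'M[R]_n) i j :
  series (fun k => expcoef X k i j) @ \oo --> expmx X i j.
Proof. by rewrite expmxE; exact: is_cvg_expmx_entry. Qed.

Lemma expmx0 (R : realType) (n : nat) : expmx (0 : 'M[R]_n) = 1%:M.
Proof.
(* The partial sum of index 0 is empty, so the sequence is constant only from index 1 on. *)
apply: expmx_lim => i j; rewrite -(cvg_shiftn 1).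
rewrite [X in X @ _](_ : _ = cst ((1%:M : 'M[R]_n) i j)); first exact: cvg_cst.
apply/funext => N; rewrite /= addn1 /series /= big_nat_recl //= big1 ?addr0.
  by rewrite /expcoef expr0 fact0 invr1 scale1r.
by move=> k _; rewrite /expcoef exprmxS mul0mx scaler0 mxE.
Qed.

Lemma trmx_exp (R : realType) (n : nat) (X : 'M[R]_n) k : (X ^+ k)^T = X^T ^+ k.
Proof.
elim: k => [|k IH]; first by rewrite !expr0 trmx1.
by rewrite exprmxS trmx_mul IH -[X in _ *m X]expr1 -[LHS]exprD addn1.
Qed.

Lemma trmx_expmx (R : realType) (n : nat) (X : 'M[R]_n) :
  (expmx X)^T = expmx X^T.
Proof.
apply/esym/expmx_lim => i j; rewrite mxE.
rewrite [X in series X](_ : _ = fun k => expcoef X k j i); first exact: cvg_expmx.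
by apply/funext => k; rewrite /expcoef -trmx_exp !mxE.
Qed.

Lemma cvg_sumr (R : realType) (T : Type) (F : set_system T) (FF : Filter F)
    (I : Type) (r : seq I) (f : I -> T -> R) (l : I -> R) :
  (forall i, f i @ F --> l i) ->
  (fun x => \sum_(i <- r) f i x) @ F --> \sum_(i <- r) l i.
Proof.
move=> fl; elim: r => [|i r IH].
  by rewrite big_nil; under eq_fun do rewrite big_nil; exact: cvg_cst.
by rewrite big_cons; under eq_fun do rewrite big_cons; exact: cvgD.
Qed.

Lemma sum_triangle (V : nmodType) (g : nat -> nat -> V) N :
  \sum_(0 <= k < N) \sum_(0 <= i < k.+1) g i (k - i)%N =
  \sum_(0 <= i < N) \sum_(0 <= j < N | (i + j < N)%N) g i j.
Proof.
transitivity (\sum_(0 <= i < N) \sum_(0 <= j < N - i) g i j).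
  elim: N => [|N IH]; first by rewrite !big_geq.
  rewrite big_nat_recr //= IH [RHS]big_nat_recr //= subSnn big_nat1.
  rewrite [X in _ + X]big_nat_recr //= subnn addrA; congr (_ + _).
  rewrite -big_split /= !big_nat; apply: eq_bigr => i /andP[_ iN].
  by rewrite subSn ?(ltnW iN) // big_nat_recr.
rewrite !big_nat; apply: eq_bigr => i /andP[_ iN].
rewrite (@big_nat_widen _ _ _ _ _ N) ?leq_subr //.
by apply: eq_bigl => j /=; rewrite ltn_subRL.
Qed.

(** A product of two partial sums runs over a square of indices, a partial sum of the Cauchy product
    over the triangle below the antidiagonal; the last term is their difference. *)
Lemma sum_square_triangle (V : nmodType) (g : nat -> nat -> V) N :
  \sum_(0 <= i < N) \sum_(0 <= j < N) g i j =
  \sum_(0 <= k < N) \sum_(0 <= i < k.+1) g i (k - i)%N +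
  \sum_(0 <= i < N) \sum_(0 <= j < N | ~~ (i + j < N)%N) g i j.
Proof.
rewrite sum_triangle -big_split /=; apply: eq_bigr => i _.
exact: (bigID (fun j => (i + j < N)%N)).
Qed.

Lemma exp_coeffD (R : realType) (x y : R) k :
  exp_coeff (x + y) k =
  \sum_(0 <= i < k.+1) exp_coeff x (k - i)%N * exp_coeff y i.
Proof.
rewrite /exp_coeff /= exprDn mulr_suml big_mkord; apply: eq_bigr => i _.
have ik : (i <= k)%N by rewrite -ltnS.
have /(congr1 (fun n => n%:R : R)) := bin_fact ik.
rewrite !natrM -mulr_natr => <-.
have h1 : (k - i)`!%:R != 0 :> R by rewrite pnatr_eq0 -lt0n fact_gt0.
have h2 : i`!%:R != 0 :> R by rewrite pnatr_eq0 -lt0n fact_gt0.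
have h3 : (binomial k i)%:R != 0 :> R by rewrite pnatr_eq0 -lt0n bin_gt0.
by field; rewrite h1 h2 h3.
Qed.

Lemma expcoefD (R : realType) (n : nat) (X Y : 'M[R]_n) k :
  X *m Y = Y *m X ->
  expcoef (X + Y) k =
  \sum_(0 <= i < k.+1) expcoef X (k - i)%N *m expcoef Y i.
Proof.
move=> XY; rewrite /expcoef /= exprDn_comm // scaler_sumr big_mkord.
apply: eq_bigr => i _.
have ik : (i <= k)%N by rewrite -ltnS.
rewrite -scalemxAl -scalemxAr scalerA -(scaler_nat (binomial k i)) scalerA.
congr (_ *: _).
have /(congr1 (fun n => n%:R : R)) := bin_fact ik.
rewrite !natrM => <-.
have h1 : (k - i)`!%:R != 0 :> R by rewrite pnatr_eq0 -lt0n fact_gt0.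
have h2 : i`!%:R != 0 :> R by rewrite pnatr_eq0 -lt0n fact_gt0.
have h3 : (binomial k i)%:R != 0 :> R by rewrite pnatr_eq0 -lt0n bin_gt0.
by field; rewrite h1 h2 h3.
Qed.

Lemma normr_expcoef_mul_le (R : realType) (n : nat) (X Y : 'M[R]_n) i j a b :
  `|(expcoef X j *m expcoef Y i) a b| <=
  exp_coeff (mx1norm X) j * exp_coeff (mx1norm Y) i.
Proof.
have step c d : `|(X ^+ j *m Y ^+ i) c d| <= mx1norm X ^+ j * mx1norm Y ^+ i.
  elim: j c d => [|j IH] c d.
    by rewrite !expr0 mul1mx mul1r normr_exprmx_le.
  rewrite exprmxS -mulmxA exprS -mulrA; apply: normr_mulmx_le => //.
  by rewrite mulr_ge0 // exprn_ge0 // mx1norm_ge0.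
rewrite /expcoef -scalemxAl -scalemxAr scalerA mxE normrM.
rewrite ger0_norm ?mulr_ge0 ?invr_ge0 // /exp_coeff /= mulrACA mulrC.
by rewrite ler_wpM2r ?mulr_ge0 ?invr_ge0.
Qed.

(** The defect [D] between the product of the partial sums and the partial sum for [X + Y] is the
    part of the square outside the triangle. Entrywise it is bounded by the same defect [e] of the
    scalar series at the two norms, and [e] tends to 0 by the functional equation of the real
    exponential. *)
Theorem expmxD (R : realType) (n : nat) (X Y : 'M[R]_n) :
  X *m Y = Y *m X -> expmx (X + Y) = expmx X *m expmx Y.
Proof.
move=> XY; apply/esym/matrixP => a b; rewrite mxE.
pose D (N : nat) := \sum_(0 <= i < N) \sum_(0 <= j < N | ~~ (i + j < N)%N)
  (expcoef X j *m expcoef Y i) a b.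
pose e (N : nat) := series (exp_coeff (mx1norm X)) N *
  series (exp_coeff (mx1norm Y)) N -
  series (exp_coeff (mx1norm X + mx1norm Y)) N.
have DE N : D N = (\sum_c series (fun k => expcoef X k a c) N *
                           series (fun k => expcoef Y k c b) N) -
                  series (fun k => expcoef (X + Y) k a b) N.
  apply/eqP; rewrite eq_sym subr_eq addrC /D; apply/eqP.
  transitivity (\sum_(0 <= i < N) \sum_(0 <= j < N)
      (expcoef X j *m expcoef Y i) a b).
    under eq_bigr do rewrite mulr_sumr.
    rewrite exchange_big /=; apply: eq_bigr => i _.
    under eq_bigr do rewrite mulr_suml.
    by rewrite exchange_big /=; apply: eq_bigr => j _; rewrite mxE.
  rewrite sum_square_triangle; congr (_ + _).
  by apply: eq_bigr => k _; rewrite expcoefD // summxE.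
have eE N : e N = \sum_(0 <= i < N) \sum_(0 <= j < N | ~~ (i + j < N)%N)
    exp_coeff (mx1norm X) j * exp_coeff (mx1norm Y) i.
  apply/eqP; rewrite /e subr_eq addrC; apply/eqP.
  rewrite [LHS](_ : _ = \sum_(0 <= i < N) \sum_(0 <= j < N)
      exp_coeff (mx1norm X) j * exp_coeff (mx1norm Y) i).
    rewrite sum_square_triangle; congr (_ + _).
    by apply: eq_bigr => k _; rewrite exp_coeffD.
  by rewrite mulr_sumr; apply: eq_bigr => i _; rewrite mulr_suml.
have e0 : e @ \oo --> (0 : R).
  rewrite -(subrr (expR (mx1norm X + mx1norm Y))) {1}expRD.
  by apply: cvgB; [apply: cvgM|]; exact: is_cvg_series_exp_coeff.
have D0 : D @ \oo --> (0 : R).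
  apply: (@squeeze_cvgr _ _ _ _ (fun N => - e N) e) => //; last first.
    by rewrite -oppr0; apply: cvgN.
  near=> N; rewrite -ler_norml; rewrite eE.
  apply: le_trans (ler_norm_sum _ _ _) _; apply: ler_sum => i _.
  apply: le_trans (ler_norm_sum _ _ _) _; apply: ler_sum => j _.
  exact: normr_expcoef_mul_le.
have D1 : D @ \oo --> (\sum_c expmx X a c * expmx Y c b) - expmx (X + Y) a b.
  rewrite (_ : D = fun N => (\sum_c series (fun k => expcoef X k a c) N *
                           series (fun k => expcoef Y k c b) N) -
                  series (fun k => expcoef (X + Y) k a b) N); last exact/funext.
  apply: cvgB; last exact: cvg_expmx.
  by apply: cvg_sumr => c; apply: cvgM; exact: cvg_expmx.
by apply/eqP; rewrite -subr_eq0; apply/eqP; apply: cvg_unique D1 D0.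
Unshelve. all: by end_near.
Qed.

Lemma expmxN (R : realType) (n : nat) (X : 'M[R]_n) :
  expmx X *m expmx (- X) = 1%:M.
Proof. by rewrite -expmxD ?subrr ?expmx0 // mulmxN mulNmx. Qed.

Lemma exprmxN (R : realType) (n : nat) (X : 'M[R]_n) k :
  (- X) ^+ k = (-1) ^+ k *: X ^+ k.
Proof.
elim: k => [|k IH]; first by rewrite !expr0 scale1r.
by rewrite !exprmxS IH mulNmx -scalemxAr exprS mulN1r scaleNr.
Qed.

Lemma sym_mulmx_diag (R : realType) (n : nat) (X : 'M[R]_n) i :
  X^T = X -> (X *m X) i i = \sum_j X i j ^+ 2.
Proof.
by move=> XT; rewrite mxE; apply: eq_bigr => j _; rewrite -{2}XT mxE expr2.
Qed.

Lemma sym_exprmx_even_ge0 (R : realType) (n : nat) (X : 'M[R]_n) m i :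
  X^T = X -> 0 <= (X ^+ m.*2) i i.
Proof.
move=> XT; rewrite -addnn exprD sym_mulmx_diag; last by rewrite trmx_exp XT.
by apply: sumr_ge0 => j _; rewrite sqr_ge0.
Qed.

(** Odd powers cancel in the sum of the two exponentials, and even powers of a symmetric matrix have
    diagonal entries that are sums of squares, so the series may be cut off from below. *)
Lemma sym_expmx_diag_ge (R : realType) (n : nat) (A : 'M[R]_n) i :
  A^T = A -> 2 + (A *m A) i i <= expmx A i i + expmx (- A) i i.
Proof.
move=> AT.
pose u k := expcoef A k i i + expcoef (- A) k i i.
have uE k : u k = (1 + (-1) ^+ k) * (k`!%:R^-1 * (A ^+ k) i i).
  by rewrite /u /expcoef exprmxN !mxE mulrDl mul1r mulrCA.
have u_ge0 k : 0 <= u k.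
  rewrite uE -(odd_double_half k); case: (odd k) => /=.
    by rewrite add1n exprS -mul2n exprM sqrrN !expr1n mulr1 subrr mul0r.
  rewrite add0n -mul2n exprM sqrrN !expr1n mul2n !mulr_ge0 ?invr_ge0 //.
  exact: sym_exprmx_even_ge0.
have cu : series u @ \oo --> expmx A i i + expmx (- A) i i.
  rewrite (_ : series u = fun N => series (fun k => expcoef A k i i) N +
                           series (fun k => expcoef (- A) k i i) N).
    by apply: cvgD; exact: cvg_expmx.
  by apply/funext => N; rewrite /series /= -big_split.
have nd : nondecreasing_seq (series u).
  by apply/nondecreasing_seqP => N; rewrite seriesSr lerDl.
(* Three terms are kept: degree 0 gives 2, degree 1 vanishes, degree 2 gives the square of [A]. *)
have := nondecreasing_cvgn_le nd (cvgP _ cu) 3%N.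
rewrite (cvg_lim _ cu) //; apply: le_trans.
rewrite /series /= !big_nat_recr //= big_geq // !uE !expr0 expr1 !exprmxS mulmx1.
by rewrite !mxE eqxx !factS fact0 /=; lra.
Qed.

(** The exponential is symmetric and orthogonal, hence equal to its inverse, and its diagonal
    entries are at most 1. The lower bound 2 plus a sum of squares for twice such an entry then
    kills every entry of [A]. *)
Lemma sym_orthogonal_expmx (R : realType) (n : nat) (A : 'M[R]_n) :
  A^T = A -> (expmx A)^T *m expmx A = 1%:M -> A = 0.
Proof.
move=> AT orthE.
have ENT : expmx (- A) = expmx A.
  by rewrite -[LHS]mul1mx -orthE -mulmxA expmxN mulmx1 trmx_expmx AT.
have E1 i : expmx A i i <= 1.
  have /matrixP/(_ i i) := orthE; rewrite !mxE eqxx mulr1n (bigD1 i) //= => h.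
  have : expmx A i i ^+ 2 <= 1.
    rewrite -h !mxE -expr2 lerDl; apply: sumr_ge0 => k _.
    by rewrite mxE -expr2 sqr_ge0.
  by move=> h1; nra.
apply/matrixP => i j; rewrite mxE; apply/eqP; rewrite -sqrf_eq0.
have := sym_expmx_diag_ge i AT; rewrite ENT sym_mulmx_diag // => h.
have h2 : \sum_j A i j ^+ 2 <= 0 by have := E1 i; lra.
rewrite eq_le sqr_ge0 andbT; apply: le_trans h2.
by rewrite (bigD1 j) //= lerDl; apply: sumr_ge0 => k _; rewrite sqr_ge0.
Qed.

(** * Rotations in coordinate planes *)

(* tau exchanges the two basis vectors of each rotation plane (and fixes the
   others); the angle w i is signed, hence w (tau i) = - w i. *)
Section PlanarRotations.
Variables (R : realType) (n : nat) (tau : 'I_n -> 'I_n).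
Hypothesis tauK : involutive tau.

(** Generators, their powers and their exponentials are all supported on the diagonal and on the
    graph of [tau], so they share this one shape. *)
Definition spmx (a b : 'I_n -> R) : 'M[R]_n :=
  \matrix_(i, j) (a i * (i == j)%:R + b i * (j == tau i)%:R).

Definition genmx (w : 'I_n -> R) := spmx (fun=> 0) w.

Definition rotmx (w : 'I_n -> R) := spmx (fun i => cos (w i)) (fun i => sin (w i)).

Lemma mul_spmx a b m (M : 'M[R]_(n, m)) i j :
  (spmx a b *m M) i j = a i * M i j + b i * M (tau i) j.
Proof.
rewrite mxE; under eq_bigr do rewrite mxE mulrDl.
rewrite big_split /= (bigD1 i) //= eqxx mulr1 big1 ?addr0; last first.
  by move=> k; rewrite eq_sym => /negPf ->; rewrite mulr0 mul0r.
rewrite (bigD1 (tau i)) //= eqxx mulr1 big1 ?addr0 //.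
by move=> k /negPf ->; rewrite mulr0 mul0r.
Qed.

Lemma mulmx_spmx a b m (M : 'M[R]_(m, n)) i j :
  (M *m spmx a b) i j = M i j * a j + M i (tau j) * b (tau j).
Proof.
rewrite mxE; under eq_bigr do rewrite mxE mulrDr.
rewrite big_split /= (bigD1 j) //= eqxx mulr1 big1 ?addr0; last first.
  by move=> k /negPf ->; rewrite mulr0 mulr0.
rewrite (bigD1 (tau j)) //= tauK eqxx mulr1 big1 ?addr0 //.
by move=> k; rewrite -(inj_eq (inv_inj tauK)) tauK eq_sym => /negPf ->; rewrite !mulr0.
Qed.

(** Clearing the factorials turns the Taylor coefficients of cos and sin into the recursion obeyed
    by the powers of a planar generator. *)
Lemma fact_cos_coeffS (x : R) k :
  k.+1`!%:R * cos_coeff x k.+1 = - x * (k`!%:R * sin_coeff x k).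
Proof.
have f0 m : m`!%:R != 0 :> R by rewrite pnatr_eq0 -lt0n fact_gt0.
rewrite /cos_coeff /sin_coeff /= [LHS]mulrC [in RHS](mulrC k`!%:R) !divfK //.
rewrite negbK exprS; case: k => [|k]; first by rewrite !mul0r mulr0.
rewrite -exprnP /=; case: (odd k) => /=; rewrite ?mul0r ?mulr0 //.
by rewrite !mul1r exprS; ring.
Qed.

Lemma fact_sin_coeffS (x : R) k :
  k.+1`!%:R * sin_coeff x k.+1 = x * (k`!%:R * cos_coeff x k).
Proof.
have f0 m : m`!%:R != 0 :> R by rewrite pnatr_eq0 -lt0n fact_gt0.
rewrite /cos_coeff /sin_coeff /= [LHS]mulrC [in RHS](mulrC k`!%:R) !divfK //.
by rewrite exprS -exprnP; ring.
Qed.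

Lemma sin_coeffN (x : R) k : sin_coeff (- x) k = - sin_coeff x k.
Proof.
rewrite /sin_coeff /= (exprNn x); case: (boolP (odd k)) => ok; rewrite ?mul0r ?oppr0 //.
by rewrite -[in (-1) ^+ k]signr_odd ok expr1; ring.
Qed.

Lemma cos_coeffN (x : R) k : cos_coeff (- x) k = cos_coeff x k.
Proof.
rewrite /cos_coeff /= (exprNn x); case: (boolP (odd k)) => ok; rewrite ?mul0r //.
by rewrite -[in (-1) ^+ k]signr_odd (negPf ok) expr0; ring.
Qed.

Section Skew.
Variable w : 'I_n -> R.
Hypothesis wN : forall i, w (tau i) = - w i.

Lemma exprmx_genmx k :
  genmx w ^+ k = spmx (fun i => k`!%:R * cos_coeff (w i) k)
                      (fun i => k`!%:R * sin_coeff (w i) k).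
Proof.
elim: k => [|k IH].
  apply/matrixP => i j; rewrite expr0 !mxE /cos_coeff /sin_coeff /= fact0.
  by rewrite expr0z expr0 divr1 !(mul0r, mul1r) addr0.
rewrite exprmxS IH; apply/matrixP => i j.
rewrite mul_spmx !mxE tauK fact_cos_coeffS fact_sin_coeffS wN.
by rewrite cos_coeffN sin_coeffN (eq_sym i j) (eq_sym j (tau i)); ring.
Qed.

Lemma expmx_genmx : expmx (genmx w) = rotmx w.
Proof.
apply: expmx_lim => i j.
have -> : (fun k => expcoef (genmx w) k i j) =
    (fun k => cos_coeff (w i) k * (i == j)%:R + sin_coeff (w i) k * (j == tau i)%:R).
  apply/funext => k; rewrite /expcoef exprmx_genmx !mxE; field.
  by rewrite pnatr_eq0 -lt0n fact_gt0.
rewrite mxE [series _](_ : _ = fun N => series (cos_coeff (w i)) N * (i == j)%:R +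
  series (sin_coeff (w i)) N * (j == tau i)%:R).
  apply: cvgD; apply: cvgMr_tmp.
    by rewrite unlock; exact: is_cvg_series_cos_coeff.
  by rewrite unlock; exact: is_cvg_series_sin_coeff.
by apply/funext => N; rewrite /series /= !mulr_suml -big_split.
Qed.

End Skew.
End PlanarRotations.

Section RotationGroup.
Variables (R : realType) (n : nat) (tau : 'I_n -> 'I_n).
Hypothesis tauK : involutive tau.
Implicit Types w : 'I_n -> R.

Lemma rotmxD w w' : (forall i, w' (tau i) = - w' i) ->
  rotmx tau w *m rotmx tau w' = rotmx tau (fun i => w i + w' i).
Proof.
move=> w'N; apply/matrixP => i j.
rewrite mul_spmx !mxE tauK cosD sinD w'N cosN sinN (eq_sym i j).
by rewrite (eq_sym (tau i) j); ring.
Qed.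

Lemma eq_rotmx w w' : (forall i, cos (w i) = cos (w' i)) ->
  (forall i, sin (w i) = sin (w' i)) -> rotmx tau w = rotmx tau w'.
Proof. by move=> c s; apply/matrixP => i j; rewrite !mxE c s. Qed.

Lemma rotmx0 : rotmx tau (fun=> 0 : R) = 1%:M.
Proof.
by apply/matrixP => i j; rewrite !mxE cos0 sin0 mul1r mul0r addr0.
Qed.

Lemma trmx_rotmx w : (forall i, w (tau i) = - w i) ->
  (rotmx tau w)^T = rotmx tau (fun i => - w i).
Proof.
move=> wN; apply/matrixP => i j; rewrite !mxE cosN sinN.
have [->|ij] := eqVneq i j.
  have [tj|tj] := eqVneq j (tau j); last by rewrite !mulr0.
  have w0 : w j = 0 by have := wN j; rewrite -tj => h; lra.
  by rewrite w0 sin0 oppr0.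
rewrite !mulr0 !add0r.
have [->|itj] := eqVneq i (tau j).
  by rewrite tauK eqxx wN sinN opprK.
have -> : (j == tau i) = false.
  by apply: contraNF itj => /eqP ->; rewrite tauK.
by rewrite !mulr0.
Qed.

Lemma rotmx_mulV w : (forall i, w (tau i) = - w i) ->
  rotmx tau w *m rotmx tau (fun i => - w i) = 1%:M.
Proof.
move=> wN; rewrite rotmxD; last by move=> i; rewrite wN.
by rewrite -[RHS]rotmx0; apply: eq_rotmx => i; rewrite subrr.
Qed.

Lemma rotmx_mulVl w : (forall i, w (tau i) = - w i) ->
  rotmx tau (fun i => - w i) *m rotmx tau w = 1%:M.
Proof. by move=> wN; apply: mulmx1C; exact: rotmx_mulV. Qed.

Lemma rotmx_orthogonal w : (forall i, w (tau i) = - w i) ->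
  (rotmx tau w)^T *m rotmx tau w = 1%:M.
Proof. by move=> wN; rewrite trmx_rotmx // rotmx_mulVl. Qed.

Lemma rotmx_unit w : (forall i, w (tau i) = - w i) -> rotmx tau w \in unitmx.
Proof. by move=> wN; have /mulmx1_unit[] := rotmx_mulV wN. Qed.

Lemma invmx_rotmx w : (forall i, w (tau i) = - w i) ->
  invmx (rotmx tau w) = rotmx tau (fun i => - w i).
Proof.
move=> wN; rewrite -[LHS]mulmx1 -(rotmx_mulV wN) mulmxA mulVmx ?rotmx_unit //.
by rewrite mul1mx.
Qed.

(* A rotation is the square of another one, hence its determinant is a square
   of +1 or -1. *)
Lemma det_rotmx w : (forall i, w (tau i) = - w i) -> \det (rotmx tau w) = 1.
Proof.
move=> wN; have w2N i : w (tau i) / 2 = - (w i / 2) by rewrite wN mulNr.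
have -> : rotmx tau w = rotmx tau (fun i => w i / 2) *m rotmx tau (fun i => w i / 2).
  by rewrite rotmxD //; apply: eq_rotmx => i; rewrite -splitr.
have := congr1 determinant (rotmx_orthogonal w2N).
by rewrite !det_mulmx det_tr det1.
Qed.

Lemma continuous_rotmx w : continuous (fun s : R => rotmx tau (fun i => s * w i)).
Proof.
move=> s; apply: cvg_mx => i j; rewrite /rotmx /spmx.
under eq_fun do rewrite mxE; rewrite mxE.
have cw : (fun s => s * w i) @ s --> s * w i by apply: cvgMr_tmp.
apply: cvgD; apply: cvgMr_tmp.
  by apply: (cvg_comp _ _ cw); exact: continuous_cos.
by apply: (cvg_comp _ _ cw); exact: continuous_sin.
Qed.

Lemma spmx_diag_comm (a b : 'I_n -> R) (d : 'rV[R]_n) :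
  (forall i, d 0 (tau i) = d 0 i) ->
  spmx tau a b *m diag_mx d = diag_mx d *m spmx tau a b.
Proof.
move=> dt; apply/matrixP => i j; rewrite mul_mx_diag mul_diag_mx !mxE.
have [->|_] := eqVneq i j; first by ring.
by have [->|_] := eqVneq j (tau i); rewrite ?dt /=; ring.
Qed.

End RotationGroup.

(** * Rotations inside G and K *)

Definition esgn (R : realType) (p q : nat) (i : 'I_(p.+1 + q.+1)) : R :=
  if (i <= p)%N then 1 else -1.

Lemma etamx_diag (R : realType) (p q : nat) :
  etamx R p q = diag_mx (\row_i esgn R i).
Proof.
rewrite -[RHS]submxK /etamx; congr block_mx; apply/matrixP => i j; rewrite !mxE.
- rewrite (inj_eq (@lshift_inj _ _)) /esgn /=.
  by have := ltn_ord i; rewrite ltnS => ->.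
- by rewrite eq_lrshift.
- by rewrite eq_rlshift.
rewrite (inj_eq (@rshift_inj _ _)) /esgn /= addSn ltnNge leq_addr /=.
by rewrite mulNrn.
Qed.

Lemma special_orthogonal_sqr (R : realType) (m : nat) (A B : 'M[R]_m) :
  A^T *m A = 1%:M -> B = A *m A -> special_orthogonal B.
Proof.
move=> AA ->; split.
  by rewrite trmx_mul mulmxA -(mulmxA _ A^T A) AA mulmx1.
by have := congr1 determinant AA; rewrite !det_mulmx det_tr det1.
Qed.

Section RotationPseudoOrthogonal.
Variables (R : realType) (p q : nat).
Variables (tau : 'I_(p.+1 + q.+1) -> 'I_(p.+1 + q.+1)) (w : 'I_(p.+1 + q.+1) -> R).
Hypothesis tauK : involutive tau.
Hypothesis tau_esgn : forall i, esgn R (tau i) = esgn R i.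
Hypothesis wN : forall i, w (tau i) = - w i.

Lemma rotmx_etamx_comm (v : _ -> R) : rotmx tau v *m etamx R p q = etamx R p q *m rotmx tau v.
Proof. by rewrite etamx_diag spmx_diag_comm // => i; rewrite !mxE. Qed.

Lemma rotmx_SOpq : @SOpq R p q (rotmx tau w).
Proof.
split; last exact: det_rotmx.
by rewrite -mulmxA -rotmx_etamx_comm mulmxA rotmx_orthogonal // mul1mx.
Qed.

End RotationPseudoOrthogonal.

Section RotationSubgroups.
Variables (R : realType) (p q : nat).
Variables (tau : 'I_(p.+1 + q.+1) -> 'I_(p.+1 + q.+1)) (w : 'I_(p.+1 + q.+1) -> R).
Hypothesis tauK : involutive tau.
Hypothesis tau_esgn : forall i, esgn R (tau i) = esgn R i.
Hypothesis wN : forall i, w (tau i) = - w i.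

(** Scaling all angles by a real parameter gives a connected family in SO(p+1,q+1) through the
    identity and the given rotation. *)
Lemma rotmx_Ggrp : @Ggrp R p q (rotmx tau w).
Proof.
exists (range (fun s : R => rotmx tau (fun i => s * w i))).
  split.
  - exists 0 => //; rewrite -[RHS](rotmx0 R tau).
    by apply: eq_rotmx => i; rewrite mul0r.
  - move=> _ [s _ <-]; apply: rotmx_SOpq => // i.
    by rewrite wN mulrN.
  apply: connected_continuous_connected.
    exact/connected_intervalP.
  by apply: continuous_subspaceT; exact: continuous_rotmx.
by exists 1 => //; apply: eq_rotmx => i; rewrite mul1r.
Qed.

Lemma rotmx_block (v : _ -> R) :
  rotmx tau v = block_mx (ulsubmx (rotmx tau v)) 0 0 (drsubmx (rotmx tau v)).
Proof.
rewrite -[LHS]submxK; congr block_mx; apply/matrixP => i j.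
  rewrite !mxE eq_lrshift mulr0 add0r.
  case: eqP => [e|]; last by rewrite mulr0.
  have := tau_esgn (lshift q.+1 i); rewrite -e /esgn /= addSn ltnNge leq_addr /=.
  by have := ltn_ord i; rewrite ltnS => ->; lra.
rewrite !mxE eq_rlshift mulr0 add0r.
case: eqP => [e|]; last by rewrite mulr0.
have := tau_esgn (rshift p.+1 i); rewrite -e /esgn /= addSn ltnNge leq_addr /=.
by have := ltn_ord j; rewrite ltnS => ->; lra.
Qed.

(** K asks for determinant 1 in each block separately. Halving the angles exhibits each block as the
    square of an orthogonal matrix. *)
Lemma rotmx_Kgrp : @Kgrp R p q (rotmx tau w).
Proof.
pose h := rotmx tau (fun i => w i / 2).
have w2N i : w (tau i) / 2 = - (w i / 2) by rewrite wN mulNr.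
have hh : rotmx tau w = h *m h.
  by rewrite rotmxD //; apply: eq_rotmx => i; rewrite -splitr.
have := rotmx_orthogonal tauK w2N; rewrite -/h.
have hB : h = block_mx (ulsubmx h) 0 0 (drsubmx h) by exact: rotmx_block.
rewrite hB tr_block_mx mulmx_block !trmx0 !(mulmx0, mul0mx, addr0, add0r).
rewrite (scalar_mx_block _ _ 1) => /eq_block_mx[ul _ _ dr].
move: hh; rewrite hB mulmx_block !(mulmx0, mul0mx, addr0, add0r) => hh.
exists (ulsubmx h *m ulsubmx h), (drsubmx h *m drsubmx h); split=> //.
  exact: special_orthogonal_sqr ul _.
exact: special_orthogonal_sqr dr _.
Qed.

End RotationSubgroups.

(** * Simultaneous rotations in one positive and one negative plane *)

Lemma Fgen_entry (R : realType) (p q : nat) (m k i j : 'I_(p.+1 + q.+1)) :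
  Fgen R m k i j = esgn R k * ((j == k) && (i == m))%:R
                 - esgn R m * ((j == m) && (i == k))%:R.
Proof.
rewrite /Fgen etamx_diag !mxE (eq_sym k) (eq_sym m).
by case: (j == k); case: (j == m); case: (i == m); case: (i == k);
  rewrite /= ?mulr1n ?mulr0n; ring.
Qed.

Definition pswap (T : eqType) (a b c d i : T) : T :=
  if i == a then b else if i == b then a else
  if i == c then d else if i == d then c else i.

(* The sign of y is reversed because eta = -1 on the plane (c, d), so that birot
   below is the exponential of x F_(a,b) + y F_(c,d). *)
Definition pfreq (R : realType) (T : eqType) (a b c d : T) (x y : R) (i : T) : R :=
  if i == a then x else if i == b then - x else
  if i == c then - y else if i == d then y else 0.

Definition birot (R : realType) (n : nat) (a b c d : 'I_n) (x y : R) : 'M[R]_n :=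
  rotmx (pswap a b c d) (pfreq a b c d x y).

Section BiRotation.
Variables (R : realType) (p q : nat) (a b c d : 'I_(p.+1 + q.+1)).
Hypothesis a_pos : (a <= p)%N.
Hypothesis b_pos : (b <= p)%N.
Hypothesis c_neg : (p < c)%N.
Hypothesis d_neg : (p < d)%N.
Hypothesis ab : a != b.
Hypothesis cd : c != d.

Let ac : a != c. Proof. by apply/eqP => e; move: c_neg; rewrite -e ltnNge a_pos. Qed.
Let ad : a != d. Proof. by apply/eqP => e; move: d_neg; rewrite -e ltnNge a_pos. Qed.
Let bc : b != c. Proof. by apply/eqP => e; move: c_neg; rewrite -e ltnNge b_pos. Qed.
Let bd : b != d. Proof. by apply/eqP => e; move: d_neg; rewrite -e ltnNge b_pos. Qed.

Let ba : b != a. Proof. by rewrite eq_sym. Qed.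
Let ca : c != a. Proof. by rewrite eq_sym. Qed.
Let da : d != a. Proof. by rewrite eq_sym. Qed.
Let cb : c != b. Proof. by rewrite eq_sym. Qed.
Let db : d != b. Proof. by rewrite eq_sym. Qed.
Let dc : d != c. Proof. by rewrite eq_sym. Qed.

Let neqs := (negPf ab, negPf cd, negPf ac,
  negPf ad, negPf bc, negPf bd, negPf ba, negPf ca, negPf da, negPf cb,
  negPf db, negPf dc).

Lemma pswapK : involutive (pswap a b c d).
Proof.
move=> i; rewrite {2}/pswap.
have [->|ia] := eqVneq i a; first by rewrite /pswap !(eqxx, neqs).
have [->|ib] := eqVneq i b; first by rewrite /pswap !(eqxx, neqs).
have [->|ic] := eqVneq i c; first by rewrite /pswap !(eqxx, neqs).
have [->|id] := eqVneq i d; first by rewrite /pswap !(eqxx, neqs).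
by rewrite /pswap (negPf ia) (negPf ib) (negPf ic) (negPf id).
Qed.

Lemma pswap_esgn i : esgn R (pswap a b c d i) = esgn R i.
Proof.
rewrite /esgn /pswap.
have [->|_] := eqVneq i a; first by rewrite a_pos b_pos.
have [->|_] := eqVneq i b; first by rewrite a_pos b_pos.
have [->|_] := eqVneq i c; first by rewrite (leqNgt c) (leqNgt d) c_neg d_neg.
by have [->|_] := eqVneq i d; first by rewrite (leqNgt c) (leqNgt d) c_neg d_neg.
Qed.

Lemma pfreqN (x y : R) i :
  pfreq a b c d x y (pswap a b c d i) = - pfreq a b c d x y i.
Proof.
rewrite /pswap; have [->|ia] := eqVneq i a; first by rewrite /pfreq !(eqxx, neqs).
have [->|ib] := eqVneq i b; first by rewrite /pfreq !(eqxx, neqs) opprK.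
have [->|ic] := eqVneq i c; first by rewrite /pfreq !(eqxx, neqs) opprK.
have [->|id] := eqVneq i d; first by rewrite /pfreq !(eqxx, neqs).
by rewrite /pfreq (negPf ia) (negPf ib) (negPf ic) (negPf id) oppr0.
Qed.

Lemma pfreqE (x y : R) : ((pfreq a b c d x y a = x) * (pfreq a b c d x y b = - x) *
  (pfreq a b c d x y c = - y) * (pfreq a b c d x y d = y))%type.
Proof. by rewrite /pfreq !(eqxx, neqs). Qed.

Lemma pswapE : ((pswap a b c d a = b) * (pswap a b c d b = a) *
  (pswap a b c d c = d) * (pswap a b c d d = c))%type.
Proof. by rewrite /pswap !(eqxx, neqs). Qed.

Lemma Fgen_genmx (x y : R) :
  x *: Fgen R a b + y *: Fgen R c d = genmx (pswap a b c d) (pfreq a b c d x y).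
Proof.
have ea : esgn R a = 1 by rewrite /esgn a_pos.
have eb : esgn R b = 1 by rewrite /esgn b_pos.
have ec : esgn R c = -1 by rewrite /esgn leqNgt c_neg.
have ed : esgn R d = -1 by rewrite /esgn leqNgt d_neg.
apply/matrixP => i j;
have -> : (x *: Fgen R a b + y *: Fgen R c d) i j =
    x * Fgen R a b i j + y * Fgen R c d i j.
  by rewrite mxE; congr (_ + _); rewrite mxE.
rewrite [in RHS]mxE !Fgen_entry.
rewrite ea eb ec ed mul0r add0r !mulN1r !mul1r.
have [->|ia] := eqVneq i a.
  by rewrite pfreqE pswapE ?(eqxx, neqs) !andbF !andbT /=; ring.
have [->|ib] := eqVneq i b.
  by rewrite pfreqE pswapE ?(eqxx, neqs) !andbF !andbT /=; ring.
have [->|ic] := eqVneq i c.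
  by rewrite pfreqE pswapE ?(eqxx, neqs) !andbF !andbT /=; ring.
have [->|id] := eqVneq i d.
  by rewrite pfreqE pswapE ?(eqxx, neqs) !andbF !andbT /=; ring.
rewrite /pfreq (negPf ia) (negPf ib) (negPf ic) (negPf id) !andbF /=; ring.
Qed.

Lemma expmx_Fgen (x y : R) :
  expmx (x *: Fgen R a b + y *: Fgen R c d) = birot a b c d x y.
Proof. by rewrite Fgen_genmx (expmx_genmx pswapK (pfreqN x y)). Qed.

Lemma birotD (x y x' y' : R) :
  birot a b c d x y *m birot a b c d x' y' = birot a b c d (x + x') (y + y').
Proof.
rewrite /birot (rotmxD pswapK _ (pfreqN x' y')).
congr rotmx; apply/funext => i; rewrite /pfreq.
by case: (i == a); case: (i == b); case: (i == c); case: (i == d); rewrite /= ?opprD ?addr0.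
Qed.

Lemma eq_birot (x y x' y' : R) : cos x = cos x' -> sin x = sin x' ->
  cos y = cos y' -> sin y = sin y' -> birot a b c d x y = birot a b c d x' y'.
Proof.
move=> cx sx cy sy; apply: eq_rotmx => i; rewrite /pfreq.
  by case: (i == a); case: (i == b); case: (i == c); case: (i == d); rewrite /= ?cosN.
by case: (i == a); case: (i == b); case: (i == c); case: (i == d); rewrite /= ?sinN ?sx ?sy.
Qed.

Lemma birot0 : birot a b c d 0 0 = 1%:M :> 'M[R]_(p.+1 + q.+1).
Proof.
rewrite -(rotmx0 R (pswap a b c d)); apply: eq_rotmx => i; rewrite /pfreq;
  by case: (i == a); case: (i == b); case: (i == c); case: (i == d); rewrite /= ?oppr0.
Qed.

Lemma invmx_birot (x y : R) : invmx (birot a b c d x y) = birot a b c d (- x) (- y).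
Proof.
rewrite /birot (invmx_rotmx pswapK (pfreqN x y)).
congr rotmx; apply/funext => i; rewrite /pfreq.
by case: (i == a); case: (i == b); case: (i == c); case: (i == d); rewrite /= ?oppr0.
Qed.

Lemma birot_orthogonal (x y : R) : (birot a b c d x y)^T *m birot a b c d x y = 1%:M.
Proof. by apply: rotmx_orthogonal; [exact: pswapK|exact: pfreqN]. Qed.

Lemma birot_Kgrp (x y : R) : @Kgrp R p q (birot a b c d x y).
Proof.
by apply: rotmx_Kgrp; [exact: pswapK|exact: pswap_esgn|exact: pfreqN].
Qed.

Lemma birot_Ggrp (x y : R) : @Ggrp R p q (birot a b c d x y).
Proof.
by apply: rotmx_Ggrp; [exact: pswapK|exact: pswap_esgn|exact: pfreqN].
Qed.

Lemma birotE (x y : R) : ((birot a b c d x y a a = cos x) *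
  (birot a b c d x y d d = cos y) * (birot a b c d x y a b = sin x))%type.
Proof. by rewrite !mxE ?pfreqE ?pswapE ?(eqxx, neqs) /=; split; [split|]; ring. Qed.

End BiRotation.

Lemma Kgrp_orthogonal (R : realType) (p q : nat) (h : Mpq R p q) :
  Kgrp h -> h^T *m h = 1%:M.
Proof.
move=> [A [B [[AA _] [BB _] ->]]].
rewrite tr_block_mx mulmx_block !trmx0 !(mulmx0, mul0mx, addr0, add0r) AA BB.
by rewrite -scalar_mx_block.
Qed.

Lemma orthogonal_inv (R : realType) (n : nat) (h : 'M[R]_n) :
  h^T *m h = 1%:M -> invmx h = h^T.
Proof.
move=> hh; have hu : h \in unitmx by have [] := mulmx1_unit hh.
by rewrite -[LHS]mul1mx -hh -mulmxA mulmxV // mulmx1.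
Qed.

Lemma orthogonal_mulr (R : realType) (n : nat) (E k : 'M[R]_n) :
  k^T *m k = 1%:M -> (E *m k)^T *m (E *m k) = 1%:M -> E^T *m E = 1%:M.
Proof.
move=> /mulmx1C kk /(congr1 (fun M => k *m M *m k^T)).
by rewrite mulmx1 kk trmx_mul !mulmxA kk mul1mx -(mulmxA _ k) kk mulmx1.
Qed.

Lemma eidxE (p q mu : nat) : (mu <= (p + q).+1)%N -> eidx p q mu = mu :> nat.
Proof. by move=> h; rewrite /eidx inordK //; change (mu < (p + q.+1).+1)%N; rewrite ltnS addnS. Qed.

(** With vanishing sines the rotation multiplies e_a and e_b by one common sign, and the generator
    involves no other basis vectors. *)
Lemma rotmx_Fgen_comm (R : realType) (p q : nat)
    (tau : 'I_(p.+1 + q.+1) -> 'I_(p.+1 + q.+1)) (w : 'I_(p.+1 + q.+1) -> R)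
    (a b : 'I_(p.+1 + q.+1)) :
  involutive tau -> (forall i, w (tau i) = - w i) ->
  cos (w a) = cos (w b) -> sin (w a) = 0 -> sin (w b) = 0 ->
  rotmx tau w *m Fgen R a b = Fgen R a b *m rotmx tau w.
Proof.
move=> tauK wN cab sa sb.
have F0 i j : i != a -> i != b -> Fgen R a b i j = 0.
  by move=> /negPf ia /negPf ib; rewrite Fgen_entry ia ib !andbF !mulr0 subrr.
have F0r i j : j != a -> j != b -> Fgen R a b i j = 0.
  by move=> /negPf ia /negPf ib; rewrite Fgen_entry ia ib /= !mulr0 subrr.
apply/matrixP => i j; rewrite mul_spmx mulmx_spmx //.
have -> : sin (w i) * Fgen R a b (tau i) j = 0.
  have swi : sin (w i) = - sin (w (tau i)) by rewrite wN sinN opprK.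
  have [e|na] := eqVneq (tau i) a; first by rewrite swi e sa oppr0 mul0r.
  have [e|nb] := eqVneq (tau i) b; first by rewrite swi e sb oppr0 mul0r.
  by rewrite F0 // mulr0.
have -> : Fgen R a b i (tau j) * sin (w (tau j)) = 0.
  have [->|na] := eqVneq (tau j) a; first by rewrite sa mulr0.
  have [->|nb] := eqVneq (tau j) b; first by rewrite sb mulr0.
  by rewrite F0r // mul0r.
rewrite !addr0 mulrC.
have [->|ia] := eqVneq i a.
  have [->//|ja] := eqVneq j a; have [->|jb] := eqVneq j b; first by rewrite cab.
  by rewrite F0r // !mul0r.
have [->|ib] := eqVneq i b.
  have [->|ja] := eqVneq j a; first by rewrite cab.
  by have [->//|jb] := eqVneq j b; rewrite F0r // !mul0r.
by rewrite F0 // !mul0r.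
Qed.

(** * The torus T and the common part of K and H *)

Section SpecialIndices.
Variables (R : realType) (p q : nat).
Hypothesis q_le_p : (q <= p)%N.
Hypothesis d_gt2 : (2 < p + q)%N.
Hypothesis q_gt0 : (0 < q)%N.

Notation io := (eidx p q 0).
Notation il := (eidx p q 1).
Notation im := (eidx p q 2).
Notation iD := (eidx p q (p + q)).
Notation iL := (eidx p q (p + q).+1).

Lemma ioE : io = 0%N :> nat. Proof. exact: eidxE. Qed.
Lemma ilE : il = 1%N :> nat. Proof. by apply: eidxE; lia. Qed.
Lemma imE : im = 2%N :> nat. Proof. by apply: eidxE; lia. Qed.
Lemma iDE : iD = (p + q)%N :> nat. Proof. by apply: eidxE; lia. Qed.
Lemma iLE : iL = (p + q).+1 :> nat. Proof. exact: eidxE. Qed.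

Lemma io_pos : (io <= p)%N. Proof. by rewrite ioE. Qed.
Lemma il_pos : (il <= p)%N. Proof. by rewrite ilE; lia. Qed.
Lemma im_pos : (im <= p)%N. Proof. by rewrite imE; lia. Qed.
Lemma iD_neg : (p < iD)%N. Proof. by rewrite iDE; lia. Qed.
Lemma iL_neg : (p < iL)%N. Proof. by rewrite iLE; lia. Qed.
Lemma io_il : io != il. Proof. by apply/eqP => /(congr1 val) /=; rewrite ioE ilE. Qed.
Lemma io_im : io != im. Proof. by apply/eqP => /(congr1 val) /=; rewrite ioE imE. Qed.
Lemma il_im : il != im. Proof. by apply/eqP => /(congr1 val) /=; rewrite ilE imE. Qed.
Lemma iD_iL : iD != iL.
Proof. by apply/eqP => /(congr1 val) /=; rewrite iDE iLE; lia. Qed.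
Lemma io_iL : io != iL.
Proof. by apply/eqP => /(congr1 val) /=; rewrite ioE iLE; lia. Qed.

(** The block form of K forbids entries mixing e_0 with e_(d+1). Comparing rows 0 and d+1 in the
    commutation with [D0] then makes each of these rows of [h] a multiple of its basis vector, with
    the same coefficient in both; orthogonality makes this coefficient a sign. *)
Lemma KH_rigid (h : Mpq R p q) : (@Kgrp R p q `&` @Hgrp R p q) h ->
  exists e : R, e ^+ 2 = 1 /\
    forall j, h io j = e * (j == io)%:R /\ h iL j = e * (j == iL)%:R.
Proof.
move=> [Kh [_]]; rewrite /D0 mulNmx mulmxN => /oppr_inj hF.
have h0 (i j : 'I_(p.+1 + q.+1)) : (i <= p)%N = ~~ (j <= p)%N -> h i j = 0.
  case: Kh => A [B [_ _ ->]].
  case: (split_ordP i) => i' ->; case: (split_ordP j) => j' -> /=.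
  - by have := ltn_ord i'; have := ltn_ord j'; rewrite !ltnS => -> ->.
  - by rewrite block_mxEur mxE.
  - by rewrite block_mxEdl mxE.
  - by rewrite !addSn (leqNgt _ p) (leqNgt (p + j').+1) !ltnS !leq_addr.
have FE i j : Fmx R p q 0 (p + q).+1 i j =
    - ((i == io) && (j == iL))%:R - ((i == iL) && (j == io))%:R.
  rewrite /Fmx Fgen_entry /esgn io_pos leqNgt iL_neg /= andbC (andbC (j == io)).
  by rewrite mul1r mulN1r.
have hoL : h io iL = 0 by apply: h0; rewrite io_pos leqNgt iL_neg.
have hLo : h iL io = 0 by apply: h0; rewrite io_pos leqNgt iL_neg.
have L j : h iL j = h io io * (j == iL)%:R.
  have /matrixP/(_ io j) := hF; rewrite !mxE.
  rewrite (bigD1 io) //= (bigD1 iL) /=; last by rewrite eq_sym io_iL.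
  rewrite hoL mul0r add0r big1; last first.
    by move=> k /andP[/negPf k1 /negPf k2]; rewrite FE k1 k2 /= !mulr0n oppr0 addr0 mulr0.
  rewrite [RHS](bigD1 iL) //= [X in _ = _ + X]big1; last first.
    by move=> k /negPf k2; rewrite FE k2 andbF (negPf io_iL) /= !mulr0n oppr0 addr0 mul0r.
  rewrite !FE !eqxx (negPf io_iL) /= !mulr0n => e. lra.
have O j : h io j = h iL iL * (j == io)%:R.
  have /matrixP/(_ iL j) := hF; rewrite !mxE.
  rewrite (bigD1 iL) //= (bigD1 io) ?io_iL //= hLo mul0r add0r big1; last first.
    by move=> k /andP[/negPf k1 /negPf k2]; rewrite FE k1 k2 /= !mulr0n oppr0 addr0 mulr0.
  rewrite [RHS](bigD1 io) //= [X in _ = _ + X]big1; last first.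
    by move=> k /negPf k2; rewrite FE k2 andbF eq_sym (negPf io_iL) /= !mulr0n oppr0 addr0 mul0r.
  rewrite !FE !eqxx (eq_sym iL) (negPf io_iL) /= !mulr0n => e; lra.
have e1 : h iL iL = h io io by rewrite L eqxx mulr1.
exists (h io io); split; last by move=> j; rewrite O e1 L.
have /matrixP/(_ io io) := mulmx1C (Kgrp_orthogonal Kh).
rewrite !mxE (bigD1 io) //= big1 ?addr0 ?mxE ?eqxx ?expr2 //.
by move=> k /negPf ko; rewrite O ko mulr0 mul0r.
Qed.

Lemma KH_corner (h h' : Mpq R p q) :
  (@Kgrp R p q `&` @Hgrp R p q) h -> (@Kgrp R p q `&` @Hgrp R p q) h' ->
  exists e : R, e ^+ 2 = 1 /\ forall X : Mpq R p q,
    (h *m X *m invmx h') io io = e * X io io /\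
    (h *m X *m invmx h') iL iL = e * X iL iL.
Proof.
move=> Kh Kh'; have [e [e1 He]] := KH_rigid Kh; have [e' [e1' He']] := KH_rigid Kh'.
exists (e * e'); split; first by rewrite exprMn e1 e1' mulr1.
move=> X; rewrite (orthogonal_inv (Kgrp_orthogonal Kh'.1)).
have E (a : 'I_(p.+1 + q.+1)) : (forall j, h a j = e * (j == a)%:R) ->
    (forall j, h' a j = e' * (j == a)%:R) ->
    (h *m X *m h'^T) a a = e * e' * X a a.
  move=> ha ha'; rewrite mxE (bigD1 a) //= big1 ?addr0; last first.
    by move=> k /negPf ka; rewrite [X in _ * X]mxE ha' ka !mulr0.
  rewrite mxE (bigD1 a) //= big1 ?addr0; last first.
    by move=> k /negPf ka; rewrite ha ka mulr0 mul0r.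
  by rewrite [h'^T _ _]mxE ha ha' eqxx !mulr1; ring.
by split; apply: E => j; have [] := He j; have [] := He' j.
Qed.

Lemma iD_io : (io == iD) = false.
Proof. by apply/negP => /eqP e; have := iD_neg; rewrite -e ltnNge io_pos. Qed.
Lemma iD_il : (il == iD) = false.
Proof. by apply/negP => /eqP e; have := iD_neg; rewrite -e ltnNge il_pos. Qed.
Lemma iL_il : (il == iL) = false.
Proof. by apply/negP => /eqP e; have := iL_neg; rewrite -e ltnNge il_pos. Qed.

Definition trot (x y : R) : Mpq R p q := birot io il iD iL x y.

Lemma trotD x y x' y' : trot x y *m trot x' y' = trot (x + x') (y + y').
Proof. exact: (birotD io_pos il_pos iD_neg iL_neg io_il iD_iL). Qed.

Lemma trot0 : trot 0 0 = 1%:M.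
Proof. exact: birot0. Qed.

Lemma invmx_trot x y : invmx (trot x y) = trot (- x) (- y).
Proof. exact: (invmx_birot io_pos il_pos iD_neg iL_neg io_il iD_iL). Qed.

Lemma eq_trot x y x' y' : cos x = cos x' -> sin x = sin x' ->
  cos y = cos y' -> sin y = sin y' -> trot x y = trot x' y'.
Proof. exact: eq_birot. Qed.

Lemma trot_corner x y : trot x y io io = cos x /\ trot x y iL iL = cos y.
Proof.
by rewrite /trot !(birotE io_pos il_pos iD_neg iL_neg io_il iD_iL).
Qed.

Lemma KH_birot (a b : 'I_(p.+1 + q.+1)) (x y : R) :
  (a <= p)%N -> (b <= p)%N -> a != b ->
  cos (pfreq a b iD iL x y io) = cos (pfreq a b iD iL x y iL) ->
  sin (pfreq a b iD iL x y io) = 0 -> sin (pfreq a b iD iL x y iL) = 0 ->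
  (@Kgrp R p q `&` @Hgrp R p q) (birot a b iD iL x y).
Proof.
move=> a_pos b_pos ab c0 s0 s0'.
have tK := pswapK a_pos b_pos iD_neg iL_neg ab iD_iL.
have fN := pfreqN a_pos b_pos iD_neg iL_neg ab iD_iL x y.
split; first exact: (birot_Kgrp a_pos b_pos iD_neg iL_neg ab iD_iL).
split; first exact: (birot_Ggrp a_pos b_pos iD_neg iL_neg ab iD_iL).
by rewrite /D0 mulmxN mulNmx (rotmx_Fgen_comm tK fN c0 s0 s0').
Qed.

Lemma KH_pi : (@Kgrp R p q `&` @Hgrp R p q) (trot pi pi).
Proof.
apply: KH_birot; rewrite ?io_pos ?il_pos ?io_il //;
  by rewrite !(pfreqE io_pos il_pos iD_neg iL_neg io_il iD_iL) ?sinpi.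
Qed.

Lemma KH_1 : (@Kgrp R p q `&` @Hgrp R p q) 1%:M.
Proof.
rewrite -trot0; apply: KH_birot; rewrite ?io_pos ?il_pos ?io_il //;
  by rewrite !(pfreqE io_pos il_pos iD_neg iL_neg io_il iD_iL) ?sin0.
Qed.

(* flip changes the signs of e_1 and e_2. *)
Definition flip : Mpq R p q := birot il im iD iL pi 0.

(** This is the product of [trot pi pi] and [flip], written as a single double rotation so that
    membership in K and H follows as for the other sign matrices. *)
Definition piflip : Mpq R p q := birot io im iD iL pi pi.

Lemma KH_flip : (@Kgrp R p q `&` @Hgrp R p q) flip.
Proof.
have f0 : pfreq il im iD iL pi 0 io = 0 :> R.
  by rewrite /pfreq (negPf io_il) (negPf io_im) iD_io (negPf io_iL).
apply: KH_birot; rewrite ?im_pos ?il_pos ?il_im //;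
  by rewrite ?f0 ?(pfreqE il_pos im_pos iD_neg iL_neg il_im iD_iL) ?sin0.
Qed.

Lemma KH_piflip : (@Kgrp R p q `&` @Hgrp R p q) piflip.
Proof.
apply: KH_birot; rewrite ?io_pos ?im_pos ?io_im //;
  by rewrite !(pfreqE io_pos im_pos iD_neg iL_neg io_im iD_iL) ?sinpi.
Qed.

Lemma diag_rotmx (n : nat) (tau : 'I_n -> 'I_n) (w : 'I_n -> R) :
  (forall i, sin (w i) = 0) -> rotmx tau w = diag_mx (\row_i cos (w i)).
Proof.
move=> s0; apply/matrixP => i j; rewrite !mxE s0 mul0r addr0.
by rewrite mulr_natr.
Qed.

Lemma diag_conj_rotmx (n : nat) (tau : 'I_n -> 'I_n) (w w' : 'I_n -> R)
    (d d' : 'rV[R]_n) :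
  (forall i, d 0 i * d' 0 i = 1) -> (forall i, cos (w i) = cos (w' i)) ->
  (forall i, d 0 i * d' 0 (tau i) * sin (w i) = sin (w' i)) ->
  diag_mx d *m rotmx tau w *m diag_mx d' = rotmx tau w'.
Proof.
move=> dd cw sw; rewrite mul_mx_diag mul_diag_mx; apply/matrixP => i j; rewrite !mxE.
rewrite -sw -cw mulrDr mulrDl; congr (_ + _).
  have [->|_] := eqVneq i j; last by rewrite !(mulr0, mul0r).
  by rewrite mulr1 mulrAC dd mul1r.
have [->|_] := eqVneq j (tau i); last by rewrite !(mulr0, mul0r).
by rewrite !mulr1 mulrAC.
Qed.

(** Changing the sign of e_1 reverses the orientation of the plane of e_0 and e_1. The sign of e_2,
    which lies outside both planes of T, only restores determinant 1. *)
Lemma flip_conj x y : flip *m trot x y *m invmx flip = trot (- x) y.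
Proof.
rewrite /flip (invmx_birot il_pos im_pos iD_neg iL_neg il_im iD_iL).
have s0 (e : R) i : e = pi \/ e = - pi -> sin (pfreq il im iD iL e 0 i) = 0.
  move=> ee; rewrite /pfreq; case: (i == il); case: (i == im); case: (i == iD);
  case: (i == iL); rewrite /= ?sinN ?oppr0 ?sin0 ?oppr0 //;
  by case: ee => ->; rewrite ?sinN ?sinpi ?oppr0.
rewrite oppr0 /birot !diag_rotmx => [|i|i]; [|by apply: s0; right|by apply: s0; left].
have f0 e : pfreq il im iD iL e 0 io = 0 :> R.
  by rewrite /pfreq (negPf io_il) (negPf io_im) iD_io (negPf io_iL).
have fF := pfreqE il_pos im_pos iD_neg iL_neg il_im iD_iL.
have fE := pfreqE io_pos il_pos iD_neg iL_neg io_il iD_iL.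
have sE := pswapE io_pos il_pos iD_neg iL_neg io_il iD_iL.
apply: diag_conj_rotmx => i.
- rewrite !mxE /pfreq; case: (i == il); case: (i == im); case: (i == iD);
  by case: (i == iL); rewrite /= ?oppr0 ?opprK ?cosN ?cospi ?cos0; ring.
- by rewrite /pfreq; case: (i == io); case: (i == il); rewrite ?cosN.
have [->|i1] := eqVneq i io.
  by rewrite !mxE !fE sE !fF !f0 cosN cos0 cospi sinN; ring.
have [->|i2] := eqVneq i il.
  by rewrite !mxE !fE sE !fF !f0 cos0 cospi opprK sinN; ring.
have [->|i3] := eqVneq i iD.
  by rewrite !mxE !fE sE !fF oppr0 cos0; ring.
have [->|i4] := eqVneq i iL.
  by rewrite !mxE !fE sE !fF oppr0 cos0; ring.
by rewrite /pfreq (negPf i1) (negPf i2) (negPf i3) (negPf i4) sin0 mulr0.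
Qed.

Lemma piflip_flip : piflip = trot pi pi *m flip.
Proof.
rewrite /piflip /trot /flip /birot !diag_rotmx.
- rewrite mulmx_diag; congr diag_mx; apply/rowP => i; rewrite !mxE /pfreq.
  have [->|i1] := eqVneq i io.
    by rewrite (negPf io_il) (negPf io_im) iD_io (negPf io_iL) cos0 mulr1.
  have [->|i2] := eqVneq i il.
    by rewrite (negPf il_im) iD_il iL_il cosN cospi cos0; ring.
  have [->|i3] := eqVneq i im; last first.
    by case: (i == iD); case: (i == iL); rewrite ?oppr0 ?cos0 ?mulr1.
  have -> : (im == iD) = false.
    by apply/negP => /eqP e; have := iD_neg; rewrite -e ltnNge im_pos.
  have -> : (im == iL) = false.
    by apply/negP => /eqP e; have := iL_neg; rewrite -e ltnNge im_pos.
  by rewrite cos0 mul1r.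
- by move=> i; rewrite /pfreq; case: (i == il); case: (i == im); case: (i == iD);
  case: (i == iL); rewrite /= ?sinN ?oppr0 ?sin0 ?sinpi ?oppr0.
- by move=> i; rewrite /pfreq; case: (i == io); case: (i == il); case: (i == iD);
  case: (i == iL); rewrite /= ?sinN ?oppr0 ?sin0 ?sinpi ?oppr0.
- by move=> i; rewrite /pfreq; case: (i == io); case: (i == im); case: (i == iD);
  case: (i == iL); rewrite /= ?sinN ?oppr0 ?sin0 ?sinpi ?oppr0.
Qed.

Lemma piflip_conj x y : piflip *m trot x y *m invmx flip = trot (pi - x) (pi + y).
Proof. by rewrite piflip_flip -!mulmxA (mulmxA flip) flip_conj trotD. Qed.

Lemma pi_mul x y : trot pi pi *m trot x y *m invmx 1%:M = trot (pi + x) (pi + y).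
Proof. by rewrite invmx1 mulmx1 trotD. Qed.

(** * The involution sigma, its -1-eigenspace and the square of t *)

Definition ssgn (i : 'I_(p.+1 + q.+1)) : R :=
  if (i == 0%N :> nat) || (i == (p + q).+1 :> nat) then -1 else 1.

Lemma ssgn_sqr i : ssgn i * ssgn i = 1.
Proof. by rewrite /ssgn; case: ifP => _; ring. Qed.

Lemma sigma_mxE : sigma_mx R p q = diag_mx (\row_i ssgn i).
Proof. by []. Qed.

Lemma sigma_mx_sqr : sigma_mx R p q *m sigma_mx R p q = 1%:M.
Proof.
rewrite sigma_mxE mulmx_diag; apply/matrixP => i j; rewrite !mxE ssgn_sqr.
by [].
Qed.

Lemma invmx_sigma : invmx (sigma_mx R p q) = sigma_mx R p q.
Proof.
have [su _] := mulmx1_unit sigma_mx_sqr.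
by rewrite -[LHS]mulmx1 -sigma_mx_sqr mulKmx.
Qed.

Lemma sigma_conjE (X : Mpq R p q) i j : sigma_conj X i j = ssgn i * X i j * ssgn j.
Proof.
rewrite /sigma_conj /Admx invmx_sigma sigma_mxE mul_mx_diag mul_diag_mx !mxE.
by [].
Qed.

Lemma galgP (X : Mpq R p q) :
  galg X <-> forall i j, esgn R i * X i j = - (X j i * esgn R j).
Proof.
rewrite /galg /= etamx_diag mul_mx_diag mul_diag_mx; split=> [/matrixP h i j|h].
  by have := h i j; rewrite !mxE => /eqP; rewrite addrC addr_eq0 => /eqP.
by apply/matrixP => i j; rewrite !mxE h subrr.
Qed.

Lemma gminusP (X : Mpq R p q) :
  gminus X <-> (forall i j, esgn R i * X i j = - (X j i * esgn R j)) /\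
               (forall i j, ssgn i = ssgn j -> X i j = 0).
Proof.
rewrite /gminus /= galgP; split=> -[gX sX]; split=> //.
  move=> i j sij; have /matrixP/(_ i j) := sX.
  rewrite sigma_conjE mulrAC sij ssgn_sqr mul1r mxE => e; lra.
apply/matrixP => i j; rewrite sigma_conjE [RHS]mxE.
have := sX i j; rewrite /ssgn; case: ifP => _; case: ifP => _ h; try by ring.
  by rewrite h //; ring.
by rewrite h //; ring.
Qed.

Lemma gminusD (X Y : Mpq R p q) : gminus X -> gminus Y -> gminus (X + Y).
Proof.
move=> /gminusP[gX sX] /gminusP[gY sY]; apply/gminusP; split=> i j.
  by rewrite !mxE mulrDr gX gY; ring.
by move=> sij; rewrite mxE sX // sY // addr0.
Qed.

Lemma gminusZ k (X : Mpq R p q) : gminus X -> gminus (k *: X).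
Proof.
move=> /gminusP[gX sX]; apply/gminusP; split=> i j.
  by rewrite !mxE mulrCA gX; ring.
by move=> sij; rewrite mxE sX // mulr0.
Qed.

Lemma palgD (X Y : Mpq R p q) : palg X -> palg Y -> palg (X + Y).
Proof.
rewrite /palg /theta => -[/= /galgP gX tX] [/galgP gY tY]; split=> /=.
  by apply/galgP => i j; rewrite !mxE mulrDr gX gY; ring.
by rewrite linearD opprD tX tY opprD.
Qed.

Lemma palgZ k (X : Mpq R p q) : palg X -> palg (k *: X).
Proof.
rewrite /palg /theta => -[/= /galgP gX tX]; split=> /=.
  by apply/galgP => i j; rewrite !mxE mulrCA gX; ring.
by rewrite linearZ /= -scalerN tX scalerN.
Qed.

Lemma palg0 : @palg R p q 0.
Proof.
rewrite /palg /theta /=; split; last by rewrite trmx0 oppr0.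
by apply/galgP => i j; rewrite !mxE mulr0 mul0r oppr0.
Qed.

Lemma esgn_delta (B : bool) (i a : 'I_(p.+1 + q.+1)) :
  esgn R i * (B && (i == a))%:R = esgn R a * (B && (i == a))%:R.
Proof. by have [->|_] := eqVneq i a; rewrite ?andbF ?mulr0. Qed.

Lemma Fgen_galg (a b : 'I_(p.+1 + q.+1)) : galg (Fgen R a b).
Proof.
apply/galgP => i j; rewrite !Fgen_entry.
have E1 := esgn_delta (j == b) i a; have E2 := esgn_delta (j == a) i b.
have E3 := esgn_delta (i == b) j a; have E4 := esgn_delta (i == a) j b.
rewrite mulrBr !(mulrCA (esgn R i)) E1 E2 mulrBl -!mulrA !(mulrC _ (esgn R j)) E3 E4.
by rewrite (andbC (j == b)) (andbC (j == a)); ring.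
Qed.

Lemma Fgen_gminus (a b : 'I_(p.+1 + q.+1)) : ssgn a = - ssgn b -> gminus (Fgen R a b).
Proof.
move=> sab; apply/gminusP; split; first exact/galgP/Fgen_galg.
have sn k : ssgn k <> - ssgn k by rewrite /ssgn; case: ifP => _ h; lra.
move=> i j sij; rewrite Fgen_entry.
have -> : (j == b) && (i == a) = false.
  apply/negP => /andP[/eqP jb /eqP ia]; apply: (sn b).
  by rewrite -sab -ia sij jb.
have -> : (j == a) && (i == b) = false.
  apply/negP => /andP[/eqP ja /eqP ib]; apply: (sn b).
  by rewrite -sab -ja -sij ib.
by rewrite !mulr0 subrr.
Qed.

Lemma Fgen_palg (a b : 'I_(p.+1 + q.+1)) : esgn R a = - esgn R b -> palg (Fgen R a b).
Proof.
move=> eab; split; first exact: Fgen_galg.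
rewrite /theta; congr (- _); apply/matrixP => i j; rewrite [LHS]mxE !Fgen_entry eab.
by rewrite (andbC (i == a)) (andbC (i == b)); ring.
Qed.

Lemma Fgen_mul_disjoint (a b c d : 'I_(p.+1 + q.+1)) :
  a != c -> a != d -> b != c -> b != d -> Fgen R a b *m Fgen R c d = 0.
Proof.
move=> ac ad bc bd; apply/matrixP => i j; rewrite mxE [RHS]mxE big1 // => k _.
rewrite !Fgen_entry.
have [->|_] := eqVneq k b.
  by rewrite (negPf bc) (negPf bd) !andbF /= !mulr0 subr0 mulr0.
have [->|_] := eqVneq k a.
  by rewrite (negPf ac) (negPf ad) !andbF /= !mulr0 subr0 mulr0.
by rewrite /= !mulr0 subr0 mul0r.
Qed.

Lemma ssgn_vals : ((ssgn io = -1) * (ssgn iL = -1) * (ssgn il = 1) *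
  (ssgn im = 1) * (ssgn iD = 1))%type.
Proof.
have so : ssgn io = -1 by rewrite /ssgn ioE.
have sL : ssgn iL = -1 by rewrite /ssgn iLE eqxx orbT.
have sl : ssgn il = 1 by rewrite /ssgn ilE /=; case: eqP => // ?; lia.
have sD : ssgn iD = 1.
  by rewrite /ssgn iDE; case: eqP => [?|_]; [lia|case: eqP => // ?; lia].
have sm : ssgn im = 1 by rewrite /ssgn imE /=; case: eqP => // ?; lia.
by rewrite so sL sl sm sD.
Qed.

Lemma sigma_trot x y : sigma_mx R p q *m trot x y = trot (- x) (- y) *m sigma_mx R p q.
Proof.
suff : sigma_mx R p q *m trot x y *m sigma_mx R p q = trot (- x) (- y).
  by move=> <-; rewrite -!mulmxA sigma_mx_sqr mulmx1.
have fE := pfreqE io_pos il_pos iD_neg iL_neg io_il iD_iL.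
have sE := pswapE io_pos il_pos iD_neg iL_neg io_il iD_iL.
rewrite sigma_mxE; apply: diag_conj_rotmx => i.
- by rewrite !mxE ssgn_sqr.
- by rewrite /pfreq; case: (i == io); case: (i == il); case: (i == iD);
    case: (i == iL); rewrite ?cosN.
rewrite !mxE.
have [->|i1] := eqVneq i io; first by rewrite !fE sE !ssgn_vals sinN; ring.
have [->|i2] := eqVneq i il; first by rewrite !fE sE !ssgn_vals !sinN; ring.
have [->|i3] := eqVneq i iD; first by rewrite !fE sE !ssgn_vals !sinN; ring.
have [->|i4] := eqVneq i iL; first by rewrite !fE sE !ssgn_vals !sinN; ring.
by rewrite /pfreq (negPf i1) (negPf i2) (negPf i3) (negPf i4) sin0 mulr0.
Qed.

Lemma trmx_trot x y : (trot x y)^T = trot (- x) (- y).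
Proof.
rewrite -invmx_trot orthogonal_inv //.
exact: (birot_orthogonal io_pos il_pos iD_neg iL_neg io_il iD_iL).
Qed.

Lemma trot_etamx x y : trot x y *m etamx R p q = etamx R p q *m trot x y.
Proof.
apply: rotmx_etamx_comm => i.
exact: (pswap_esgn R io_pos il_pos iD_neg iL_neg).
Qed.

Lemma trotVK x y : trot (- x) (- y) *m trot x y = 1%:M.
Proof. by rewrite trotD !addNr trot0. Qed.

Lemma trotKV x y : trot x y *m trot (- x) (- y) = 1%:M.
Proof. by rewrite trotD !subrr trot0. Qed.

Lemma sigma_conj_trot x y (X : Mpq R p q) : sigma_conj X = - X ->
  sigma_conj (trot (- x) (- y) *m X *m trot x y) =
  - (trot x y *m X *m trot (- x) (- y)).
Proof.
rewrite /sigma_conj /Admx invmx_sigma => sX.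
rewrite !mulmxA sigma_trot !opprK -!mulmxA.
have -> : trot x y *m sigma_mx R p q = sigma_mx R p q *m trot (- x) (- y).
  by rewrite sigma_trot !opprK.
rewrite (mulmxA (sigma_mx R p q) X) (mulmxA (_ *m X)) sX.
by rewrite mulNmx mulmxN.
Qed.

(* Since conjugation by sigma inverts t, the element t^-1 X t is again
   sigma-skew exactly when X commutes with the square of t. *)
Lemma gminus_Ad_trot x y (X : Mpq R p q) : gminus X ->
  (Admx (trot x y) @` @gminus R p q) X <->
  trot (x + x) (y + y) *m X = X *m trot (x + x) (y + y).
Proof.
move=> [gX sX]; rewrite -!trotD; split.
  move=> [Y [gY sY] XE].
  have YE : Y = trot (- x) (- y) *m X *m trot x y.
    rewrite -XE /Admx invmx_trot !mulmxA trotVK mul1mx -mulmxA trotVK.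
    by rewrite mulmx1.
  have := sigma_conj_trot x y sX; rewrite -YE sY YE => /oppr_inj.
  move=> /(congr1 (fun M => trot x y *m M *m trot x y)).
  rewrite !mulmxA trotKV mul1mx => e.
  by move: e; rewrite -[RHS]mulmxA trotVK mulmx1 => <-.
move=> tX; exists (trot (- x) (- y) *m X *m trot x y); last first.
  by rewrite /Admx invmx_trot !mulmxA trotKV mul1mx -mulmxA trotKV mulmx1.
split; last first.
  rewrite sigma_conj_trot //; congr (- _).
  have : trot x y *m (trot x y *m X) *m trot (- x) (- y) = X *m trot x y.
    by rewrite mulmxA tX -!mulmxA trotKV mulmx1.
  move=> /(congr1 (mulmx (trot (- x) (- y)))).
  by rewrite !mulmxA trotVK mul1mx.
rewrite /galg /= !trmx_mul !trmx_trot !opprK.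
have e1 : trot x y *m etamx R p q = etamx R p q *m trot x y := trot_etamx x y.
have e2 : etamx R p q *m trot (- x) (- y) = trot (- x) (- y) *m etamx R p q.
  by rewrite trot_etamx.
have -> : trot (- x) (- y) *m (X^T *m trot x y) *m etamx R p q =
    trot (- x) (- y) *m (X^T *m etamx R p q) *m trot x y.
  by rewrite -!mulmxA e1.
have -> : etamx R p q *m (trot (- x) (- y) *m X *m trot x y) =
    trot (- x) (- y) *m (etamx R p q *m X) *m trot x y.
  by rewrite !mulmxA e2.
by rewrite -mulmxDl -mulmxDr gX mulmx0 mul0mx.
Qed.

Lemma cosDpipi (x : R) : cos (x + (pi + pi)) = cos x.
Proof. by rewrite addrA !cosDpi opprK. Qed.

Lemma sinDpipi (x : R) : sin (x + (pi + pi)) = sin x.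
Proof. by rewrite addrA !sinDpi opprK. Qed.

Lemma Tgrp_trot x y : Tgrp (trot x y).
Proof.
exists (x *: Fmx R p q 0 1 + y *: Fmx R p q (p + q) (p + q).+1).
  by apply: memv_add; rewrite memvZ ?memv_line.
rewrite mulmx1 /Fmx.
exact: (expmx_Fgen io_pos il_pos iD_neg iL_neg io_il iD_iL).
Qed.

Lemma tmxE x y : tmx p q x y = trot x y.
Proof. exact: (expmx_Fgen io_pos il_pos iD_neg iL_neg io_il iD_iL). Qed.

Lemma talgP (X : Mpq R p q) : X \in talg R p q ->
  exists x y, X = x *: Fmx R p q 0 1 + y *: Fmx R p q (p + q) (p + q).+1.
Proof.
by move=> /memv_addP[_ /vlineP[x ->] [_ /vlineP[y ->] ->]]; exists x, y.
Qed.

Lemma TgrpP (t : Mpq R p q) : Tgrp t -> exists x y, t = trot x y.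
Proof.
by move=> [_ /talgP[x [y ->]] <-]; exists x, y; rewrite mulmx1 -tmxE.
Qed.

(** The two chosen entries of [u] and [v] form a triangular array with nonzero diagonal. *)
Lemma independent_lines (u v : Mpq R p q) i1 j1 i2 j2 :
  u i1 j1 != 0 -> v i1 j1 = 0 -> v i2 j2 != 0 ->
  \dim (<[u]> + <[v]>) = 2%N /\ (<[u]> :&: <[v]> = 0)%VS.
Proof.
move=> u1 v1 v2; have cap0 : (<[u]> :&: <[v]> = 0)%VS.
  apply/eqP; rewrite -subv0; apply/subvP => w /memv_capP[/vlineP[k ->] /vlineP[m]].
  move=> /matrixP/(_ i1 j1); rewrite !mxE v1 mulr0 => /eqP.
  by rewrite mulf_eq0 (negPf u1) orbF => /eqP ->; rewrite scale0r mem0v.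
split=> //; rewrite dimv_disjoint_sum // !dim_vline.
have -> : u != 0 by apply: contraNneq u1 => ->; rewrite mxE.
by have -> : v != 0 by apply: contraNneq v2 => ->; rewrite mxE.
Qed.

Lemma esgn_neq0 (i : 'I_(p.+1 + q.+1)) : esgn R i != 0.
Proof. by rewrite /esgn; case: ifP => _; rewrite ?oppr_eq0 oner_eq0. Qed.

Lemma Fgen_main (a b : 'I_(p.+1 + q.+1)) : a != b -> Fgen R a b a b = esgn R b.
Proof.
by move=> ab; rewrite Fgen_entry !eqxx (negPf ab) andbF /= mulr1 mulr0 subr0.
Qed.

Lemma Fgen_off (a b i j : 'I_(p.+1 + q.+1)) :
  ~~ ((j == b) && (i == a)) -> ~~ ((j == a) && (i == b)) -> Fgen R a b i j = 0.
Proof. by move=> /negPf h1 /negPf h2; rewrite Fgen_entry h1 h2 !mulr0 subr0. Qed.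

Lemma calgE : calg R p q = talg R p q.
Proof. by rewrite /calg /aalg addv0. Qed.

Lemma dim_talg : \dim (talg R p q) = 2%N.
Proof.
apply: (proj1 (@independent_lines _ _ io il iD iL _ _ _)).
- by rewrite /Fmx Fgen_main ?io_il // esgn_neq0.
- by rewrite /Fmx Fgen_off // ?iD_io ?(negPf io_iL) ?andbF.
- by rewrite /Fmx Fgen_main ?iD_iL // esgn_neq0.
Qed.

(** Every representative is spanned by two explicit generators, so all conditions are reduced to
    these; the one involving Ad(t) becomes commutation with the square of [t]. *)
Lemma standard_cartan_of_lines x y (X1 X2 : Mpq R p q) t' a' i1 j1 i2 j2 :
  X1 i1 j1 != 0 -> X2 i1 j1 = 0 -> X2 i2 j2 != 0 ->
  gminus X1 -> gminus X2 -> X1 *m X2 = X2 *m X1 ->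
  trot (x + x) (y + y) *m X1 = X1 *m trot (x + x) (y + y) ->
  trot (x + x) (y + y) *m X2 = X2 *m trot (x + x) (y + y) ->
  (<[X1]> + <[X2]> = t' + a')%VS -> (t' :&: a' = 0)%VS -> (t' <= talg R p q)%VS ->
  (forall X, X \in a' -> palg X) ->
  standard_cartan_data (trot x y) (<[X1]> + <[X2]>)%VS t' a'.
Proof.
move=> w1 w2 w3 g1 g2 X12 t1 t2 csum cap0 tt pa.
have gm X : X \in (<[X1]> + <[X2]>)%VS -> gminus X.
  move=> /memv_addP[_ /vlineP[k ->] [_ /vlineP[m ->] ->]].
  by apply: gminusD; exact: gminusZ.
split=> //.
- exact: Tgrp_trot.
- move=> X cX; apply/gminus_Ad_trot; first exact: gm.
  move: cX => /memv_addP[_ /vlineP[k ->] [_ /vlineP[m ->] ->]].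
  by rewrite mulmxDr mulmxDl -!scalemxAl -!scalemxAr t1 t2.
- move=> X Y /memv_addP[_ /vlineP[k ->] [_ /vlineP[m ->] ->]].
  move=> /memv_addP[_ /vlineP[k' ->] [_ /vlineP[m' ->] ->]].
  pose Y' := k' *: X1 + m' *: X2; rewrite -/Y'.
  have c1 : X1 *m Y' = Y' *m X1.
    by rewrite mulmxDr mulmxDl -!scalemxAl -!scalemxAr X12.
  have c2 : X2 *m Y' = Y' *m X2.
    by rewrite mulmxDr mulmxDl -!scalemxAl -!scalemxAr X12.
  by rewrite mulmxDl -!scalemxAl c1 c2 mulmxDr -!scalemxAr.
- exact: sub0v.
- by rewrite calgE dim_talg; have [] := independent_lines w1 w2 w3.
Qed.

Lemma palg_line (X Y : Mpq R p q) : palg X -> Y \in <[X]>%VS -> palg Y.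
Proof. by move=> pX /vlineP[k ->]; exact: palgZ. Qed.

Lemma palg_lines (X X' Y : Mpq R p q) :
  palg X -> palg X' -> Y \in (<[X]> + <[X']>)%VS -> palg Y.
Proof.
move=> pX pX' /memv_addP[_ /vlineP[k ->] [_ /vlineP[m ->] ->]].
by apply: palgD; exact: palgZ.
Qed.

Lemma exp_coset_line (X t : Mpq R p q) :
  exp_coset <[X]>%VS t = range (fun x => expmx (x *: X) *m t).
Proof.
apply/seteqP; split=> [_ [_ /vlineP[k ->] <-]|_ [k _ <-]]; first by exists k.
by exists (k *: X) => //; rewrite /= memvZ ?memv_line.
Qed.

Lemma exp_coset0 (t : Mpq R p q) : exp_coset 0%VS t = [set t].
Proof.
apply/seteqP; split=> [_ [X X0 <-]|_ ->].
  by move: X0; rewrite /= memv0 => /eqP ->; rewrite expmx0 mul1mx.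
by exists 0; rewrite /= ?mem0v // expmx0 mul1mx.
Qed.

Lemma exp_coset_talg x y :
  exp_coset (talg R p q) (trot x y) = range (fun s : R * R => trot s.1 s.2).
Proof.
apply/seteqP; split=> [_ [_ /talgP[k [m ->]] <-]|_ [[k m] _ <-]].
  rewrite -[expmx _]/(tmx p q k m) tmxE trotD.
  by exists (k + x, m + y).
exists ((k - x) *: Fmx R p q 0 1 + (m - y) *: Fmx R p q (p + q) (p + q).+1).
  by apply: memv_add; rewrite memvZ ?memv_line.
by rewrite -[expmx _]/(tmx p q (k - x) (m - y)) tmxE trotD !subrK.
Qed.

Lemma expmx_diag01 s (k m : R) :
  expmx (s *: (k *: Fmx R p q 0 1 + m *: Fmx R p q (p + q) (p + q).+1)) =
  trot (s * k) (s * m).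
Proof.
by rewrite scalerDr !scalerA -[expmx _]/(tmx p q (s * k) (s * m)) tmxE.
Qed.

Lemma exp_coset_torus_line (k m x y : R) :
  exp_coset <[k *: Fmx R p q 0 1 + m *: Fmx R p q (p + q) (p + q).+1]>%VS (trot x y)
  = range (fun s => trot (s * k + x) (s * m + y)).
Proof.
by rewrite exp_coset_line; apply: eq_range => s; rewrite expmx_diag01 trotD.
Qed.

(** * The representatives *)

(** These are the compact parts [T'] of the eight representatives, in the angle coordinates of T. *)
Definition torus_rep (l : cartan_label) : set (Mpq R p q) :=
  match l with
  | Rep1 => range (fun s : R * R => trot s.1 s.2)
  | Rep2 => range (fun s => trot s s)
  | Rep3 => range (fun s => trot s (s + pi))
  | Rep4 => range (fun s => trot s 0)
  | Rep5 => range (fun s => trot 0 s)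
  | Rep6 => [set trot 0 0]
  | Rep7 => [set trot (pi / 2) (pi / 2)]
  | Rep8 => [set trot 0 pi]
  end.

Lemma trot_pipi : trot (0 + 0) (pi + pi) = 1%:M.
Proof.
by rewrite -trot0; apply: eq_trot; rewrite ?addr0 // -[pi + pi]add0r
  ?cosDpipi ?sinDpipi.
Qed.

Lemma im_iL : (im == iL) = false.
Proof. by apply/negP => /eqP e; have := iL_neg; rewrite -e ltnNge im_pos. Qed.

Lemma esgn_vals : ((esgn R io = 1) * (esgn R iL = -1) * (esgn R il = 1) *
  (esgn R im = 1) * (esgn R iD = -1))%type.
Proof. by rewrite /esgn io_pos il_pos im_pos !(leqNgt _ p) iD_neg iL_neg. Qed.

Lemma idx_neqs :
  (((io == il) = false) * ((il == io) = false) * ((iD == iL) = false) *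
   ((iL == iD) = false) * ((io == iD) = false) * ((iD == io) = false) *
   ((io == iL) = false) * ((iL == io) = false) * ((il == iD) = false) *
   ((iD == il) = false) * ((il == iL) = false) * ((iL == il) = false))%type.
Proof.
have h (a b : 'I_(p.+1 + q.+1)) : (a == b) = false -> (b == a) = false.
  by rewrite eq_sym.
have h1 := negPf io_il; have h2 := negPf iD_iL; have h3 := negPf io_iL.
by split; [do !split|]; rewrite ?h1 ?h2 ?h3 ?iD_io ?iD_il ?iL_il //; apply: h;
  rewrite ?h1 ?h2 ?h3 ?iD_io ?iD_il ?iL_il.
Qed.

Lemma idx_cases (i : 'I_(p.+1 + q.+1)) :
  [\/ i = io, i = il, i = iD | i = iL \/
   [/\ (i == io) = false, (i == il) = false, (i == iD) = false,
    (i == iL) = false & ((pswap io il iD iL i = i) *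
    (forall x y : R, pfreq io il iD iL x y i = 0))%type]].
Proof.
have [->|/negPf i1] := eqVneq i io; first by constructor.
have [->|/negPf i2] := eqVneq i il; first by constructor.
have [->|/negPf i3] := eqVneq i iD; first by constructor.
have [->|/negPf i4] := eqVneq i iL; first by constructor; left.
by constructor; right; rewrite /pswap /pfreq i1 i2 i3 i4.
Qed.

(** Of the four brackets, two are multiples of F_(1,d) and two of F_(0,d+1), and each pair cancels.
    The check is entrywise: both matrices vanish outside the four indices 0, 1, d, d+1. *)
Lemma diag_anti_comm :
  (Fgen R io il + Fgen R iD iL) *m (Fgen R io iD - Fgen R il iL) =
  (Fgen R io iD - Fgen R il iL) *m (Fgen R io il + Fgen R iD iL).
Proof.
have fE := pfreqE io_pos il_pos iD_neg iL_neg io_il iD_iL.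
have sE := pswapE io_pos il_pos iD_neg iL_neg io_il iD_iL.
have sK := pswapK io_pos il_pos iD_neg iL_neg io_il iD_iL.
have FE := Fgen_genmx io_pos il_pos iD_neg iL_neg io_il iD_iL (1 : R) 1.
rewrite -[Fgen R io il]scale1r -[Fgen R iD iL]scale1r FE /genmx.
set M := _ - _.
have ME i j : M i j = - ((i == io) && (j == iD))%:R - ((i == iD) && (j == io))%:R
    + ((i == il) && (j == iL))%:R + ((i == iL) && (j == il))%:R.
  rewrite /M mxE [X in _ + X]mxE !Fgen_entry !esgn_vals.
  rewrite (andbC (i == io)) (andbC (i == iD)) (andbC (i == il)) (andbC (i == iL)).
  by ring.
apply/matrixP => i j; rewrite mul_spmx mulmx_spmx // mul0r mulr0 !add0r !ME.
case: (idx_cases i) => [->|->|->|[->|[i1 i2 i3 i4 i5]]];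
case: (idx_cases j) => [->|->|->|[->|[j1 j2 j3 j4 j5]]];
by rewrite ?fE ?sE ?fE ?i5 ?j5 ?i1 ?i2 ?i3 ?i4 ?j1 ?j2 ?j3 ?j4 ?idx_neqs
  ?eqxx ?andbF /=; ring.
Qed.

Lemma torus_rep_pair l : cartan_label_ok q l ->
  standard_cartan_pair (cartan_rep R p q l) (torus_rep l).
Proof.
have fE := pfreqE io_pos il_pos iD_neg iL_neg io_il iD_iL.
have tK := pswapK io_pos il_pos iD_neg iL_neg io_il iD_iL.
have fN := pfreqN io_pos il_pos iD_neg iL_neg io_il iD_iL.
have comm00 (X : Mpq R p q) : trot (0 + 0) (0 + 0) *m X = X *m trot (0 + 0) (0 + 0).
  by rewrite addr0 trot0 mul1mx mulmx1.
have comm0pi (X : Mpq R p q) : trot (0 + 0) (pi + pi) *m X = X *m trot (0 + 0) (pi + pi).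
  by rewrite trot_pipi mul1mx mulmx1.
have g01 : gminus (Fgen R io il) by apply: Fgen_gminus; rewrite !ssgn_vals.
have gDL : gminus (Fgen R iD iL) by apply: Fgen_gminus; rewrite !ssgn_vals opprK.
have g0D : gminus (Fgen R io iD) by apply: Fgen_gminus; rewrite !ssgn_vals.
have g1L : gminus (Fgen R il iL) by apply: Fgen_gminus; rewrite !ssgn_vals opprK.
have g2L : gminus (Fgen R im iL) by apply: Fgen_gminus; rewrite !ssgn_vals opprK.
have p0D : palg (Fgen R io iD) by apply: Fgen_palg; rewrite !esgn_vals opprK.
have p1L : palg (Fgen R il iL) by apply: Fgen_palg; rewrite !esgn_vals opprK.
have p2L : palg (Fgen R im iL) by apply: Fgen_palg; rewrite !esgn_vals opprK.
have mainE (a b : 'I_(p.+1 + q.+1)) : a != b -> Fgen R a b a b != 0.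
  by move=> ab; rewrite Fgen_main // esgn_neq0.
(* Common to classes 6, 7 and 8, which differ only in [t]. *)
have noncompact x y : trot (x + x) (y + y) *m Fgen R io iD =
      Fgen R io iD *m trot (x + x) (y + y) ->
    trot (x + x) (y + y) *m Fgen R il iL =
      Fgen R il iL *m trot (x + x) (y + y) ->
    standard_cartan_data (trot x y) (<[Fgen R io iD]> + <[Fgen R il iL]>)%VS 0%VS
      (<[Fgen R io iD]> + <[Fgen R il iL]>)%VS.
  move=> c1 c2.
  apply: (@standard_cartan_of_lines x y _ _ _ _ io iD il iL) => //.
  - by rewrite mainE // idx_neqs.
  - by rewrite Fgen_off // ?idx_neqs ?andbF.
  - by rewrite mainE // idx_neqs.
  - by rewrite !Fgen_mul_disjoint // ?idx_neqs.
  - by rewrite add0v.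
  - by rewrite cap0v.
  - exact: sub0v.
  - by move=> X; exact: palg_lines.
(* Common to classes 2 and 3. *)
have anti x y : trot (x + x) (y + y) *m (Fgen R io iD - Fgen R il iL) =
      (Fgen R io iD - Fgen R il iL) *m trot (x + x) (y + y) ->
    trot (x + x) (y + y) *m (Fgen R io il + Fgen R iD iL) =
      (Fgen R io il + Fgen R iD iL) *m trot (x + x) (y + y) ->
    standard_cartan_data (trot x y)
      (<[Fgen R io il + Fgen R iD iL]> + <[Fgen R io iD - Fgen R il iL]>)%VS
      <[Fgen R io il + Fgen R iD iL]>%VS <[Fgen R io iD - Fgen R il iL]>%VS.
  move=> c1 c2.
  have w1 : (Fgen R io il + Fgen R iD iL) io il != 0.
    by rewrite mxE [X in _ + X]Fgen_off ?addr0 ?mainE ?idx_neqs ?andbF.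
  have w2 : (Fgen R io iD - Fgen R il iL) io il = 0.
    by rewrite mxE [X in _ + X]mxE !Fgen_off ?subr0 ?idx_neqs ?andbF ?andFb.
  have w3 : (Fgen R io iD - Fgen R il iL) io iD != 0.
    rewrite mxE [X in _ + X]mxE [X in _ - X]Fgen_off ?idx_neqs ?andbF //.
    by rewrite subr0 mainE ?idx_neqs.
  apply: (standard_cartan_of_lines w1 w2 w3) => //.
  - exact: gminusD.
  - by rewrite -scaleN1r; apply: gminusD => //; exact: gminusZ.
  - exact: diag_anti_comm.
  - by have [] := independent_lines w1 w2 w3.
  - apply/subvP => _ /vlineP[k ->]; rewrite scalerDr.
    by apply: memv_add; rewrite memvZ ?memv_line.
  - move=> X; apply: palg_line; rewrite -scaleN1r; apply: palgD => //.
    exact: palgZ.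
case: l => /= okl.
- exists 1%:M, (calg R p q), (talg R p q), 0%VS; split=> //; last first.
    by rewrite -trot0 exp_coset_talg.
  rewrite calgE -trot0; apply: (@standard_cartan_of_lines 0 0 _ _ _ _ io il iD iL) => //.
  - by rewrite mainE // idx_neqs.
  - by rewrite Fgen_off // ?idx_neqs ?andbF.
  - by rewrite mainE // idx_neqs.
  - by rewrite /Fmx !Fgen_mul_disjoint // ?idx_neqs.
  - by rewrite addv0.
  - by rewrite capv0.
  - by move=> X; rewrite memv0 => /eqP ->; exact: palg0.
- exists (trot 0 0), (<[Fgen R io il + Fgen R iD iL]> + <[Fgen R io iD - Fgen R il iL]>)%VS,
    <[Fgen R io il + Fgen R iD iL]>%VS, <[Fgen R io iD - Fgen R il iL]>%VS.
  split; [exact: anti|by rewrite trot0|].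
  have := exp_coset_torus_line 1 1 0 0; rewrite !scale1r => ->.
  apply: eq_range => s.
  by rewrite mulr1 addr0.
- exists (trot 0 pi), (<[Fgen R io il + Fgen R iD iL]> + <[Fgen R io iD - Fgen R il iL]>)%VS,
    <[Fgen R io il + Fgen R iD iL]>%VS, <[Fgen R io iD - Fgen R il iL]>%VS.
  split; [exact: anti|by rewrite tmxE|].
  have := exp_coset_torus_line 1 1 0 pi; rewrite !scale1r => ->.
  apply: eq_range => s.
  by rewrite mulr1 addr0.
- exists (trot 0 0), (<[Fgen R io il]> + <[Fgen R im iL]>)%VS,
    <[Fgen R io il]>%VS, <[Fgen R im iL]>%VS.
  have w1 : Fgen R io il io il != 0 by rewrite mainE // idx_neqs.
  have w2 : Fgen R im iL io il = 0 by rewrite Fgen_off // ?idx_neqs ?andbF.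
  have w3 : Fgen R im iL im iL != 0 by rewrite mainE // im_iL.
  split; last 2 first.
  - by rewrite trot0.
  - have := exp_coset_torus_line 1 0 0 0; rewrite scale1r scale0r addr0 => ->.
    apply: eq_range => s.
    by rewrite mulr1 mulr0 !addr0.
  apply: (standard_cartan_of_lines w1 w2 w3) => //.
  - by rewrite !Fgen_mul_disjoint // ?(eq_sym im) ?(negPf io_im) ?(negPf il_im) ?idx_neqs.
  - by have [] := independent_lines w1 w2 w3.
  - by rewrite addvSl.
  - by move=> X; exact: palg_line.
(* Only for q > 1 is the index d-1 negative, which puts F_(0,d-1) into p. *)
- have q2 : (1 < q)%N by case: (q) q_gt0 okl => [|[]].
  pose ie := eidx p q (p + q).-1.
  have ieE : ie = (p + q).-1 :> nat by apply: eidxE; lia.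
  have ie_neg : (p < ie)%N by rewrite ieE; lia.
  have io_ie : io != ie by apply/eqP => /(congr1 val) /=; rewrite ioE ieE; lia.
  have iD_ie : iD != ie by apply/eqP => /(congr1 val) /=; rewrite iDE ieE; lia.
  have iL_ie : iL != ie by apply/eqP => /(congr1 val) /=; rewrite iLE ieE; lia.
  have sie : ssgn ie = 1.
    rewrite /ssgn ieE; case: eqP => [?|_]; first by lia.
    by case: eqP => [?|//]; lia.
  have eie : esgn R ie = -1 by rewrite /esgn (leqNgt _ p) ie_neg.
  exists (trot 0 0), (<[Fgen R iD iL]> + <[Fgen R io ie]>)%VS,
    <[Fgen R iD iL]>%VS, <[Fgen R io ie]>%VS.
  have w1 : Fgen R iD iL iD iL != 0 by rewrite mainE // idx_neqs.
  have w2 : Fgen R io ie iD iL = 0.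
    by rewrite Fgen_off // ?idx_neqs ?(negPf iL_ie) ?andbF.
  have w3 : Fgen R io ie io ie != 0 by rewrite mainE.
  split; last 2 first.
  - by rewrite trot0.
  - have := exp_coset_torus_line 0 1 0 0; rewrite scale1r scale0r add0r => ->.
    apply: eq_range => s.
    by rewrite mulr1 mulr0 !addr0.
  apply: (standard_cartan_of_lines w1 w2 w3) => //.
  - by apply: Fgen_gminus; rewrite sie ssgn_vals.
  - by rewrite !Fgen_mul_disjoint // ?idx_neqs // eq_sym.
  - by have [] := independent_lines w1 w2 w3.
  - by rewrite addvSr.
  - by move=> X; apply: palg_line; apply: Fgen_palg; rewrite eie esgn_vals opprK.
- exists (trot 0 0), (<[Fgen R io iD]> + <[Fgen R il iL]>)%VS, 0%VS,
    (<[Fgen R io iD]> + <[Fgen R il iL]>)%VS.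
  by split; [exact: noncompact|rewrite trot0|rewrite exp_coset0].
- exists (trot (pi / 2) (pi / 2)), (<[Fgen R io iD]> + <[Fgen R il iL]>)%VS, 0%VS,
    (<[Fgen R io iD]> + <[Fgen R il iL]>)%VS.
  (* Here the square of [t] is [trot pi pi], which is -1 on all four vectors occurring in the two
     generators. *)
  split; [apply: noncompact|by rewrite tmxE|by rewrite exp_coset0];
    rewrite -splitr; apply: (rotmx_Fgen_comm tK (fN _ _ _));
    by rewrite !fE ?cosN ?sinN ?sinpi ?oppr0.
- exists (trot 0 pi), (<[Fgen R io iD]> + <[Fgen R il iL]>)%VS, 0%VS,
    (<[Fgen R io iD]> + <[Fgen R il iL]>)%VS.
  by split; [exact: noncompact|rewrite tmxE|rewrite exp_coset0].
Qed.

(** An element splits as exp(A) times exp(S) t with the second factor orthogonal, so it is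
    orthogonal only if exp(A) is. Hence [T'] depends on [C'] alone, whatever decomposition was
    chosen. *)
Lemma standard_cartan_compact (C' T' : set (Mpq R p q)) :
  standard_cartan_pair C' T' -> T' = [set x | C' x /\ x^T *m x = 1%:M].
Proof.
move=> [t [c' [t' [a' [[tT _ _ cc cE _ tt _ ap _] -> ->]]]]].
have [x [y tE]] := TgrpP tT.
have tc X : X \in t' -> X \in c' by rewrite cE; apply/subvP; exact: addvSl.
have ac X : X \in a' -> X \in c' by rewrite cE; apply/subvP; exact: addvSr.
have orth (X : Mpq R p q) : X \in t' ->
    (expmx X *m t)^T *m (expmx X *m t) = 1%:M.
  move=> /(subvP tt) /talgP[k [m ->]].
  rewrite tE -[expmx _]/(tmx p q k m) tmxE trotD.
  exact: (birot_orthogonal io_pos il_pos iD_neg iL_neg io_il iD_iL).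
apply/seteqP; split=> [_ [X tX <-]|_ [[X cX <-]]].
  by split; [exists X => //; exact: tc|exact: orth].
move: cX; rewrite /= cE => /memv_addP[S tS [A aA ->]].
have [_ AT] := ap _ aA; have {}AT : A^T = A by move: AT; rewrite /theta => /oppr_inj.
rewrite addrC expmxD; last by apply: cc; [exact: ac|exact: tc].
rewrite -mulmxA => Ak.
have A0 : A = 0.
  by apply: sym_orthogonal_expmx => //; exact: orthogonal_mulr (orth _ tS) Ak.
by exists S => //; rewrite A0 expmx0 mul1mx.
Qed.

Lemma standard_cartan_pair_uniq (C' T1 T2 : set (Mpq R p q)) :
  standard_cartan_pair C' T1 -> standard_cartan_pair C' T2 -> T1 = T2.
Proof. by move=> /standard_cartan_compact-> /standard_cartan_compact->. Qed.

Lemma standard_cartan_compact_trot (C' T' : set (Mpq R p q)) :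
  standard_cartan_pair C' T' -> forall u, T' u -> exists x y, u = trot x y.
Proof.
move=> [t [c' [t' [a' [[tT _ _ _ _ _ tt _ _ _] _ ->]]]]] _ [X tX <-].
have [x [y ->]] := TgrpP tT; have [k [m ->]] := talgP (subvP tt _ tX).
rewrite -[expmx _]/(tmx p q k m) tmxE trotD.
by exists (k + x), (m + y).
Qed.

Lemma cartan_rep5_exists : standard_cartan (cartan_rep R p q Rep5) -> q <> 1%N.
Proof.
move=> [T' CT] q1.
(* For q = 1 the generator F_(0,d-1) is a rotation of the positive plane
   (e_0, e_p), so the fifth set has an orthogonal element outside T. *)
pose ie := eidx p q (p + q).-1.
have ieE : ie = p :> nat by rewrite eidxE; lia.
have ie_pos : (ie <= p)%N by rewrite ieE.
have ne (a : 'I_(p.+1 + q.+1)) : a != p :> nat -> (ie == a) = false.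
  by move=> h; apply/eqP => e; move: h; rewrite -e ieE eqxx.
have io_ie : io != ie by rewrite eq_sym ne // ioE; lia.
(* The quarter turn has entry 1 at (0, d-1), a position where every element of T has entry 0. *)
pose g := birot io ie iD iL (pi / 2) (0 : R) : Mpq R p q.
have : T' g.
  rewrite (standard_cartan_compact CT); split; last first.
    exact: (birot_orthogonal io_pos ie_pos iD_neg iL_neg io_ie iD_iL).
  exists (0 *: Fgen R iD iL + (pi / 2) *: Fgen R io ie).
    by apply: memv_add; rewrite memvZ ?memv_line.
  rewrite addrC mulmx1.
  exact: (expmx_Fgen io_pos ie_pos iD_neg iL_neg io_ie iD_iL).
move=> /(standard_cartan_compact_trot CT)[x [y /matrixP/(_ io ie)]].
rewrite (birotE io_pos ie_pos iD_neg iL_neg io_ie iD_iL) sin_pihalf mxE.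
rewrite (negPf io_ie) (pswapE io_pos il_pos iD_neg iL_neg io_il iD_iL) ne ?ilE; last first.
  by lia.
by rewrite !mulr0 addr0 => /eqP; rewrite oner_eq0.
Qed.

(** * Separation of the classes *)

(** For [a] and [b] among -1, 0, 1 this decides whether they occur as corner entries in class [l].
    Integers and Booleans let the eight labels be compared by computation. *)
Definition corner_sign (l : cartan_label) (a b : int) : bool :=
  match l with
  | Rep1 => true
  | Rep2 => b == a
  | Rep3 => b == - a
  | Rep4 => b == 1
  | Rep5 => a == 1
  | Rep6 => (a == 1) && (b == 1)
  | Rep7 => (a == 0) && (b == 0)
  | Rep8 => (a == 1) && (b == -1)
  end.

Lemma corner_signP l (a b : int) :
  -1 <= a <= 1 -> -1 <= b <= 1 ->
  (exists2 u, torus_rep l u & u io io = a%:~R /\ u iL iL = b%:~R) <->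
  corner_sign l a b.
Proof.
move=> a1 b1; have acosK' (c : int) : -1 <= c <= 1 -> cos (acos (c%:~R : R)) = c%:~R.
  by rewrite -(ler_int R (-1)) -(ler_int R c 1) mulrN1z => c1; rewrite acosK.
have inj (c d : int) : (c%:~R = d%:~R :> R) -> c = d by move/intr_inj.
have inj1 (c : int) : (1 = c%:~R :> R) -> c = 1 by move/(inj 1).
have inj0 (c : int) : (0 = c%:~R :> R) -> c = 0 by move/(inj 0).
have injN1 (c : int) : (-1 = c%:~R :> R) -> c = -1 by rewrite -mulrN1z => /(inj (-1)).
have aE := acosK' _ a1; have bE := acosK' _ b1.
have tc := trot_corner.
split.
  case: l => //= -[u].
  - move=> [s _ <-]; have [-> ->] := tc s s => -[-> /inj ->].
    by rewrite eqxx.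
  - move=> [s _ <-]; have [-> ->] := tc s (s + pi).
    by rewrite cosDpi => -[->]; rewrite -mulrNz => /inj ->.
  - by move=> [s _ <-]; have [-> ->] := tc s 0; rewrite cos0 => -[_ /inj1 ->].
  - by move=> [s _ <-]; have [-> ->] := tc 0 s; rewrite cos0 => -[/inj1 -> _].
  - by move=> ->; have [-> ->] := tc 0 0; rewrite cos0 => -[/inj1 -> /inj1 ->].
  - move=> ->; have [-> ->] := tc (pi / 2) (pi / 2).
    by rewrite cos_pihalf => -[/inj0 -> /inj0 ->].
  - move=> ->; have [-> ->] := tc 0 pi; rewrite cos0 cospi.
    by move=> [/inj1 -> /injN1 ->].
case: l => /=.
- by move=> _; exists (trot (acos a%:~R) (acos b%:~R)); [exists (acos a%:~R, acos b%:~R)|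
    rewrite !(fst (tc _ _), snd (tc _ _))].
- move=> /eqP ->; exists (trot (acos a%:~R) (acos a%:~R)); first by exists (acos a%:~R).
  by have [-> ->] := tc (acos a%:~R) (acos a%:~R).
- move=> /eqP ->; exists (trot (acos a%:~R) (acos a%:~R + pi)); first by exists (acos a%:~R).
  by have [-> ->] := tc (acos a%:~R) (acos a%:~R + pi); rewrite cosDpi aE mulrNz.
- move=> /eqP ->; exists (trot (acos a%:~R) 0); first by exists (acos a%:~R).
  by have [-> ->] := tc (acos a%:~R) 0; rewrite cos0.
- move=> /eqP ->; exists (trot 0 (acos b%:~R)); first by exists (acos b%:~R).
  by have [-> ->] := tc 0 (acos b%:~R); rewrite cos0.
- move=> /andP[/eqP-> /eqP->]; exists (trot 0 0) => //.
  by have [-> ->] := tc 0 0; rewrite cos0.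
- move=> /andP[/eqP-> /eqP->]; exists (trot (pi / 2) (pi / 2)) => //.
  by have [-> ->] := tc (pi / 2) (pi / 2); rewrite cos_pihalf.
- move=> /andP[/eqP-> /eqP->]; exists (trot 0 pi) => //.
  by have [-> ->] := tc 0 pi; rewrite cos0 cospi.
Qed.

(* The pair of corner entries (x_00, x_(d+1,d+1)) is invariant up to a common
   sign; whether it takes the values (1,0), (0,1), (0,0), (1,1), (1,-1)
   separates the eight classes. *)
Lemma cartan_rep_conj_inj l1 l2 : cartan_label_ok q l1 -> cartan_label_ok q l2 ->
  cartan_conj (cartan_rep R p q l1) (cartan_rep R p q l2) -> l1 = l2.
Proof.
move=> ok1 ok2 [T1 [T2 [C1 C2 [h [h' [Kh Kh' hT]]]]]].
have T1E := standard_cartan_pair_uniq C1 (torus_rep_pair ok1).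
have T2E := standard_cartan_pair_uniq C2 (torus_rep_pair ok2).
have [e [e1 eE]] := KH_corner Kh Kh'.
have {}e1 : e = 1 \/ e = -1.
  by have /eqP := e1; rewrite sqrf_eq1 => /orP[] /eqP ->; [left|right].
have N1 (c : int) : -1 <= c <= 1 -> -1 <= - c <= 1 by move=> ?; lia.
(* A conjugation may negate both corner entries at once, so only the symmetrised test is
   invariant. *)
pose S l (a b : int) := corner_sign l a b || corner_sign l (- a) (- b).
have S12 a b : -1 <= a <= 1 -> -1 <= b <= 1 -> S l1 a b = S l2 a b.
  move=> a1 b1.
  have to2 c d : -1 <= c <= 1 -> -1 <= d <= 1 -> corner_sign l1 c d -> S l2 c d.
    move=> c1 d1 /(corner_signP _ c1 d1)[u Tu [uo uL]].
    have T2u : torus_rep l2 (h *m u *m invmx h').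
      by rewrite -T2E -hT; exists u => //; rewrite T1E.
    have [] := eE u; rewrite uo uL => ho hL; apply/orP.
    case: e1 => e1; move: ho hL; rewrite e1 ?mul1r ?mulN1r -?mulrNz => ho hL.
      by left; apply/(corner_signP _ c1 d1); exists (h *m u *m invmx h').
    right; apply/(corner_signP _ (N1 _ c1) (N1 _ d1)).
    by exists (h *m u *m invmx h').
  have to1 c d : -1 <= c <= 1 -> -1 <= d <= 1 -> corner_sign l2 c d -> S l1 c d.
    move=> c1 d1 /(corner_signP _ c1 d1)[u].
    rewrite -T2E -hT T1E => -[v Tv <-].
    have [-> ->] := eE v => -[vo vL]; apply/orP.
    case: e1 => e1; move: vo vL; rewrite e1 ?mul1r ?mulN1r => vo vL.
      by left; apply/(corner_signP _ c1 d1); exists v.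
    right; apply/(corner_signP _ (N1 _ c1) (N1 _ d1)).
    by exists v => //; rewrite !mulrNz -vo -vL !opprK.
  have SN l c d : S l (- c) (- d) = S l c d by rewrite /S !opprK orbC.
  apply/idP/idP => /orP[].
  - exact: to2.
  - by move=> /(to2 _ _ (N1 _ a1) (N1 _ b1)); rewrite SN.
  - exact: to1.
  - by move=> /(to1 _ _ (N1 _ a1) (N1 _ b1)); rewrite SN.
have := S12 1 0 isT isT; have := S12 0 1 isT isT; have := S12 0 0 isT isT.
have := S12 1 1 isT isT; have := S12 1 (-1) isT isT.
by clear; case: l1; case: l2.
Qed.

(** * Classification *)

(* The space p \cap g^(-sigma): symmetric matrices whose only nonzero entries
   are u_j = A_(0,j) with e_j negative, j <> d+1, and v_i = A_(i,d+1) with e_i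
   positive, i <> 0, together with their transposes. Two such matrices commute
   exactly when their u and their v are both proportional. *)
Definition pminus (A : Mpq R p q) : Prop := palg A /\ gminus A.

Lemma pminus_sym (A : Mpq R p q) i j : pminus A -> A i j = A j i.
Proof.
by move=> [[_ tA] _]; move: tA; rewrite /theta => /oppr_inj {1}<-; rewrite mxE.
Qed.

Lemma pminus_esgn (A : Mpq R p q) i j :
  pminus A -> esgn R i = esgn R j -> A i j = 0.
Proof.
move=> pA eij; have [[/galgP/(_ i j) + _] _] := pA.
rewrite eij (pminus_sym i j pA) /esgn; case: ifP => _ h; lra.
Qed.

Lemma pminus_ssgn (A : Mpq R p q) i j : pminus A -> ssgn i = ssgn j -> A i j = 0.
Proof. by move=> [_ /gminusP[_]]; apply. Qed.

Lemma ssgn1 (i : 'I_(p.+1 + q.+1)) : i != io -> i != iL -> ssgn i = 1.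
Proof.
move=> /eqP i0 /eqP i1; rewrite /ssgn; case: eqP => [e|_].
  by case: i0; apply: val_inj; rewrite /= ioE.
by case: eqP => [e|//]; case: i1; apply: val_inj; rewrite /= iLE.
Qed.

Lemma pminus_pos (A : Mpq R p q) (i j : 'I_(p.+1 + q.+1)) :
  pminus A -> (i <= p)%N -> i != io -> j != iL -> A i j = 0.
Proof.
move=> pA ip i0 jL; have [->|j0] := eqVneq j io.
  by apply: pminus_esgn => //; rewrite /esgn ip io_pos.
apply: pminus_ssgn => //; rewrite !ssgn1 //.
by apply: contraTneq ip => ->; rewrite -ltnNge iL_neg.
Qed.

Lemma pminus_neg (A : Mpq R p q) (i j : 'I_(p.+1 + q.+1)) :
  pminus A -> (p < i)%N -> i != iL -> j != io -> A i j = 0.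
Proof.
move=> pA ip i0 jL; have [->|j0] := eqVneq j iL.
  by apply: pminus_esgn => //; rewrite /esgn !(leqNgt _ p) ip iL_neg.
apply: pminus_ssgn => //; rewrite !ssgn1 //.
by apply: contraTneq ip => ->; rewrite -leqNgt io_pos.
Qed.

Lemma pminus_eq0 (A : Mpq R p q) : pminus A ->
  (forall j : 'I_(p.+1 + q.+1), (p < j)%N -> j != iL -> A io j = 0) ->
  (forall i : 'I_(p.+1 + q.+1), (i <= p)%N -> i != io -> A i iL = 0) -> A = 0.
Proof.
move=> pA u0 v0.
have o0 j : A io j = 0.
  have [jp|jp] := leqP j p; first by apply: pminus_esgn; rewrite // /esgn jp io_pos.
  have [->|jL] := eqVneq j iL; last exact: u0.
  by apply: pminus_ssgn; rewrite // !ssgn_vals.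
have L0 i : A i iL = 0.
  have [->|i0] := eqVneq i io; first exact: o0.
  have [ip|ip] := leqP i p; first exact: v0.
  by apply: pminus_esgn; rewrite // /esgn !(leqNgt _ p) ip iL_neg.
apply/matrixP => i j; rewrite [RHS]mxE.
have [->|jL] := eqVneq j iL; first exact: L0.
have [->|iL'] := eqVneq i iL; first by rewrite pminus_sym.
have [->|i0] := eqVneq i io; first exact: o0.
have [->|j0] := eqVneq j io; first by rewrite pminus_sym.
by apply: pminus_ssgn; rewrite // !ssgn1.
Qed.

Lemma pminus_nonzero (A : Mpq R p q) : pminus A -> A != 0 ->
  (exists j : 'I_(p.+1 + q.+1), [/\ (p < j)%N, j != iL & A io j != 0]) \/
  (exists i : 'I_(p.+1 + q.+1), [/\ (i <= p)%N, i != io & A i iL != 0]).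
Proof.
move=> pA; apply: contra_neqP => /not_orP[hu hv].
apply: pminus_eq0 => // [j jp jL|i ip i0]; apply/eqP/negP => /negP nz.
  by apply: hu; exists j.
by apply: hv; exists i.
Qed.

(** * Elements of p and g^(-sigma) commuting with T or its Lie algebra *)

Section Commutation.
Variables (f g : R -> R) (x y : R) (A : Mpq R p q).
Hypothesis fN : forall s, f (- s) = - f s.
Hypothesis gN : forall s, g (- s) = g s.
Hypothesis pA : pminus A.

Let w := pfreq io il iD iL x y.
(** An odd [f] and an even [g] are all that the computation uses: sin and cos give an element of T,
    the identity and zero give an element of its Lie algebra. *)
Let M : Mpq R p q := spmx (pswap io il iD iL) (fun i => g (w i)) (fun i => f (w i)).

Hypothesis MA : M *m A = A *m M.

Let tK := pswapK io_pos il_pos iD_neg iL_neg io_il iD_iL.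
Let fE := pfreqE io_pos il_pos iD_neg iL_neg io_il iD_iL x y.
Let sE := pswapE io_pos il_pos iD_neg iL_neg io_il iD_iL.

Let MAE i j : g (w i) * A i j + f (w i) * A (pswap io il iD iL i) j =
  A i j * g (w j) + A i (pswap io il iD iL j) * f (w (pswap io il iD iL j)).
Proof. by have /matrixP/(_ i j) := MA; rewrite mul_spmx mulmx_spmx. Qed.

Let f0 : f 0 = 0. Proof. by have := fN 0; rewrite oppr0 => h; lra. Qed.

Let pA0 (i j : 'I_(p.+1 + q.+1)) : (i <= p)%N -> i != io -> j != iL -> A i j = 0.
Proof. exact: pminus_pos. Qed.

Let A_oL : A io iL = 0. Proof. by apply: pminus_ssgn; rewrite // !ssgn_vals. Qed.
Let A_lD : A il iD = 0. Proof. by rewrite pA0 ?il_pos ?idx_neqs ?iD_iL // eq_sym io_il. Qed.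

Let swap_out (i : 'I_(p.+1 + q.+1)) : i != io -> i != il -> i != iD -> i != iL ->
  pswap io il iD iL i = i /\ w i = 0.
Proof.
by move=> /negPf i1 /negPf i2 /negPf i3 /negPf i4; rewrite /w /pswap /pfreq i1 i2 i3 i4.
Qed.

(** Such an e_j lies outside both planes, where [M] is the scalar [g 0]; if [A] couples e_0 to it,
    [M] must act by that scalar on e_0 as well. *)
Lemma comm_neg (j : 'I_(p.+1 + q.+1)) : (p < j)%N -> j != iD -> j != iL ->
  f x * A io j = 0 /\ (g x - g 0) * A io j = 0.
Proof.
move=> jp jD jL; have j0 : j != io.
  by apply: contraTneq jp => ->; rewrite -leqNgt io_pos.
have jl : j != il by apply: contraTneq jp => ->; rewrite -leqNgt il_pos.
have [sj wj] := swap_out j0 jl jD jL.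
have A_lj : A il j = 0 by rewrite pA0 ?il_pos // eq_sym io_il.
have h1 := MAE il j; have h2 := MAE io j; move: h1 h2.
rewrite sj wj !sE /w !fE fN gN f0 A_lj => h1 h2; split; first by lra.
by rewrite mulrBl; lra.
Qed.

Lemma comm_pos (i : 'I_(p.+1 + q.+1)) : (i <= p)%N -> i != io -> i != il ->
  f y * A i iL = 0 /\ (g y - g 0) * A i iL = 0.
Proof.
move=> ip i0 il'; have iD' : i != iD.
  by apply: contraTneq ip => ->; rewrite -ltnNge iD_neg.
have iL' : i != iL by apply: contraTneq ip => ->; rewrite -ltnNge iL_neg.
have [si wi] := swap_out i0 il' iD' iL'.
have A_iD : A i iD = 0 by rewrite pA0 // iD_iL.
have h1 := MAE i iD; have h2 := MAE i iL; move: h1 h2.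
rewrite si wi !sE /w !fE fN gN f0 A_iD => h1 h2; split; first by lra.
by rewrite mulrBl; lra.
Qed.

(** Between the two planes [A] has only the entries (0,d) and (1,d+1), the other two being zero; the
    four equations are the four entries of the commutation relation there. *)
Lemma comm_mid : [/\ (g x - g y) * A io iD = 0, (g x - g y) * A il iL = 0,
  f x * A il iL = - (f y * A io iD) & f x * A io iD = - (f y * A il iL)].
Proof.
have h1 := MAE io iD; have h2 := MAE il iL; have h3 := MAE io iL; have h4 := MAE il iD.
move: h1 h2 h3 h4; rewrite !sE /w !fE !fN !gN A_oL A_lD => h1 h2 h3 h4.
by split; rewrite ?mulrBl; lra.
Qed.

End Commutation.

Lemma trot_comm x y (A : Mpq R p q) : pminus A ->
  trot x y *m A = A *m trot x y ->
  [/\ forall j : 'I_(p.+1 + q.+1), (p < j)%N -> j != iD -> j != iL -> A io j != 0 ->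
        sin x = 0 /\ cos x = 1,
      forall i : 'I_(p.+1 + q.+1), (i <= p)%N -> i != io -> i != il -> A i iL != 0 ->
        sin y = 0 /\ cos y = 1 &
      [/\ (cos x - cos y) * A io iD = 0, (cos x - cos y) * A il iL = 0,
        sin x * A il iL = - (sin y * A io iD) &
        sin x * A io iD = - (sin y * A il iL)]].
Proof.
move=> pA MA; split; last exact: (comm_mid (@sinN R) (@cosN R) pA MA).
  move=> j jp jD jL Aj; have [] := comm_neg (@sinN R) (@cosN R) pA MA jp jD jL.
  move=> /eqP; rewrite mulf_eq0 (negPf Aj) orbF => /eqP ->.
  move=> /eqP; rewrite mulf_eq0 (negPf Aj) orbF subr_eq0 => /eqP ->.
  by rewrite cos0.
move=> i ip i0 il' Aj; have [] := comm_pos (@sinN R) (@cosN R) pA MA ip i0 il'.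
move=> /eqP; rewrite mulf_eq0 (negPf Aj) orbF => /eqP ->.
move=> /eqP; rewrite mulf_eq0 (negPf Aj) orbF subr_eq0 => /eqP ->.
by rewrite cos0.
Qed.

Lemma talg_comm x y (A : Mpq R p q) : pminus A ->
  let S := x *: Fmx R p q 0 1 + y *: Fmx R p q (p + q) (p + q).+1 in
  S *m A = A *m S ->
  [/\ forall j : 'I_(p.+1 + q.+1), (p < j)%N -> j != iD -> j != iL -> A io j != 0 -> x = 0,
      forall i : 'I_(p.+1 + q.+1), (i <= p)%N -> i != io -> i != il -> A i iL != 0 -> y = 0,
      x * A il iL = - (y * A io iD) & x * A io iD = - (y * A il iL)].
Proof.
move=> pA S; rewrite /S /Fmx.
rewrite (Fgen_genmx io_pos il_pos iD_neg iL_neg io_il iD_iL) => MA.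
have idN (s : R) : id (- s) = - id s by [].
have zN (s : R) : (fun=> 0) (- s) = (fun=> 0) s :> R by [].
have [_ _ h1 h2] := comm_mid idN zN pA MA.
split=> // [j jp jD jL Aj|i ip i0 il' Aj].
  have [/eqP + _] := comm_neg idN zN pA MA jp jD jL.
  by rewrite mulf_eq0 (negPf Aj) orbF => /eqP.
have [/eqP + _] := comm_pos idN zN pA MA ip i0 il'.
by rewrite mulf_eq0 (negPf Aj) orbF => /eqP.
Qed.

(** * Moving compact parts to their normal forms *)

Definition KH_map (phi : Mpq R p q -> Mpq R p q) : Prop :=
  exists h h', [/\ (@Kgrp R p q `&` @Hgrp R p q) h,
    (@Kgrp R p q `&` @Hgrp R p q) h' & phi = fun x => h *m x *m invmx h'].

Lemma cartan_conj_rep C' T' phi l : standard_cartan_pair C' T' ->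
  cartan_label_ok q l -> KH_map phi -> phi @` T' = torus_rep l ->
  cartan_conj C' (cartan_rep R p q l).
Proof.
move=> CT ok [h [h' [Kh Kh' ->]]] phiT.
by exists T', (torus_rep l); split=> //; [exact: torus_rep_pair|exists h, h'].
Qed.

Lemma KH_map_id : KH_map id.
Proof.
exists 1%:M, 1%:M; split; [exact: KH_1|exact: KH_1|].
by apply/funext => X; rewrite invmx1 mulmx1 mul1mx.
Qed.

Lemma KH_map_pi : exists2 phi, KH_map phi &
  forall x y, phi (trot x y) = trot (pi + x) (pi + y).
Proof.
exists (fun x => trot pi pi *m x *m invmx 1%:M).
  by exists (trot pi pi), 1%:M; split; [exact: KH_pi|exact: KH_1|].
exact: pi_mul.
Qed.

Lemma KH_map_flip : exists2 phi, KH_map phi &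
  forall x y, phi (trot x y) = trot (- x) y.
Proof.
exists (fun x => flip *m x *m invmx flip).
  by exists flip, flip; split; [exact: KH_flip|exact: KH_flip|].
exact: flip_conj.
Qed.

Lemma KH_map_piflip : exists2 phi, KH_map phi &
  forall x y, phi (trot x y) = trot (pi - x) (pi + y).
Proof.
exists (fun x => piflip *m x *m invmx flip).
  by exists piflip, flip; split; [exact: KH_piflip|exact: KH_flip|].
exact: piflip_conj.
Qed.

Lemma range_affine (T : Type) (F : R -> T) (k m : R) : k != 0 ->
  range (fun s => F (s * k + m)) = range F.
Proof.
move=> k0; apply/seteqP; split=> [_ [s _ <-]|_ [s _ <-]]; first by exists (s * k + m).
by exists ((s - m) / k) => //; rewrite divfK // subrK.
Qed.

Lemma cosDD_1 (x : R) : cos (x + x) = 1 -> sin x = 0 /\ (cos x = 1 \/ cos x = -1).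
Proof.
rewrite cosD => h; have := cos2Dsin2 x => h2.
have s0 : sin x = 0 by apply/eqP; rewrite -sqrf_eq0; apply/eqP; nra.
split=> //; have /eqP : cos x ^+ 2 = 1 by rewrite -h2 s0 expr0n addr0.
by rewrite sqrf_eq1 => /orP[] /eqP ->; [left|right].
Qed.

Lemma cosDD_N1 (x : R) : cos (x + x) = -1 -> cos x = 0 /\ (sin x = 1 \/ sin x = -1).
Proof.
rewrite cosD => h; have := cos2Dsin2 x => h2.
have s0 : cos x = 0 by apply/eqP; rewrite -sqrf_eq0; apply/eqP; nra.
split=> //; have /eqP : sin x ^+ 2 = 1 by rewrite -h2 s0 expr0n add0r.
by rewrite sqrf_eq1 => /orP[] /eqP ->; [left|right].
Qed.

(** The fixed angle is 0 or pi modulo a full turn. In the second case pi is added to both angles,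
    and the shift of the free angle is a reparametrisation of the line. *)
Lemma conj_rep5 C' T' x (k m : R) : standard_cartan_pair C' T' -> q <> 1%N ->
  k != 0 -> cos (x + x) = 1 ->
  T' = range (fun s => trot x (s * k + m)) ->
  cartan_conj C' (cartan_rep R p q Rep5).
Proof.
move=> CT q1 k0 /cosDD_1[s0 c1].
rewrite (range_affine (fun u => trot x u) _ k0) => T'E.
case: c1 => c1.
  apply: (cartan_conj_rep CT _ KH_map_id) => //; rewrite image_id T'E /=.
  apply: eq_range => u.
  by apply: eq_trot; rewrite ?c1 ?s0 ?cos0 ?sin0.
have [phi Kphi phiE] := KH_map_pi.
apply: (cartan_conj_rep CT _ Kphi) => //; rewrite T'E image_comp /=.
rewrite -(range_affine (fun s => trot 0 s) pi (oner_neq0 R)).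
apply: eq_range => u /=.
rewrite phiE mulr1 addrC (addrC pi u); apply: eq_trot => //.
  by rewrite cosDpi c1 opprK cos0.
by rewrite sinDpi s0 oppr0 sin0.
Qed.

Lemma conj_rep4 C' T' y (k m : R) : standard_cartan_pair C' T' ->
  k != 0 -> cos (y + y) = 1 ->
  T' = range (fun s => trot (s * k + m) y) ->
  cartan_conj C' (cartan_rep R p q Rep4).
Proof.
move=> CT k0 /cosDD_1[s0 c1].
rewrite (range_affine (fun u => trot u y) _ k0) => T'E.
case: c1 => c1.
  apply: (cartan_conj_rep CT _ KH_map_id) => //; rewrite image_id T'E /=.
  by apply: eq_range => u; apply: eq_trot; rewrite ?c1 ?s0 ?cos0 ?sin0.
have [phi Kphi phiE] := KH_map_pi.
apply: (cartan_conj_rep CT _ Kphi) => //; rewrite T'E image_comp /=.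
rewrite -(range_affine (fun s => trot s 0) pi (oner_neq0 R)).
apply: eq_range => u /=.
rewrite phiE mulr1 addrC (addrC pi y); apply: eq_trot => //.
  by rewrite cosDpi c1 opprK cos0.
by rewrite sinDpi s0 oppr0 sin0.
Qed.

(** The difference [d] of the angles is a multiple of pi, and its parity selects the class. *)
Lemma conj_rep23 C' T' phi (d : R) : standard_cartan_pair C' T' ->
  KH_map phi -> cos (d + d) = 1 ->
  phi @` T' = range (fun u => trot u (u + d)) ->
  cartan_conj C' (cartan_rep R p q Rep2) \/ cartan_conj C' (cartan_rep R p q Rep3).
Proof.
move=> CT Kphi /cosDD_1[s0 [] c1] T'E; [left|right];
  apply: (cartan_conj_rep CT _ Kphi) => //; rewrite T'E /=;
  apply: eq_range => u; apply: eq_trot => //;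
  by rewrite ?cosDpi ?sinDpi ?cosD ?sinD s0 c1; ring.
Qed.

(** If the square is 1, each cosine is a sign, and adding pi to both angles leaves only the relative
    sign: classes 6 and 8. If it is -1 on both planes, each sine is a sign, and reversing the first
    angle also removes the relative sign: class 7. *)
Lemma conj_rep678 C' x y : standard_cartan_pair C' [set trot x y] ->
  sin (x + x) = 0 -> sin (y + y) = 0 -> cos (x + x) = cos (y + y) ->
  exists2 l, cartan_label_ok q l & cartan_conj C' (cartan_rep R p q l).
Proof.
move=> CT sx sy cxy.
have conj l phi x' y' : KH_map phi -> cartan_label_ok q l ->
    torus_rep l = [set trot x' y'] -> phi (trot x y) = trot x' y' ->
    exists2 l, cartan_label_ok q l & cartan_conj C' (cartan_rep R p q l).
  move=> Kphi ok lE phiE; exists l => //.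
  by apply: (cartan_conj_rep CT ok Kphi); rewrite image_set1 phiE lE.
have [f1 K1 E1] := KH_map_pi; have [f2 K2 E2] := KH_map_flip.
have [f3 K3 E3] := KH_map_piflip.
have : cos (x + x) = 1 \/ cos (x + x) = -1.
  have := cos2Dsin2 (x + x); rewrite sx expr0n addr0 => /eqP.
  by rewrite sqrf_eq1 => /orP[] /eqP ->; [left|right].
case=> c1; have := c1; rewrite cxy => c2.
  have [{}sx cx] := cosDD_1 c1; have [{}sy cy] := cosDD_1 c2.
  case: cx => cx; case: cy => cy.
  - apply: (conj Rep6 id 0 0 KH_map_id) => //.
    by apply: eq_trot; rewrite ?cx ?cy ?sx ?sy ?cos0 ?sin0.
  - apply: (conj Rep8 id 0 pi KH_map_id) => //.
    by apply: eq_trot; rewrite ?cx ?cy ?sx ?sy ?cos0 ?sin0 ?cospi ?sinpi.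
  - apply: (conj Rep8 f1 0 pi K1) => //; rewrite E1.
    apply: eq_trot; rewrite addrC ?cosDpi ?sinDpi ?cx ?cy ?sx ?sy;
      rewrite ?opprK ?oppr0 ?cos0 ?sin0 ?cospi ?sinpi //.
  - apply: (conj Rep6 f1 0 0 K1) => //; rewrite E1.
    apply: eq_trot; rewrite addrC ?cosDpi ?sinDpi ?cx ?cy ?sx ?sy;
      rewrite ?opprK ?oppr0 ?cos0 ?sin0 ?cospi ?sinpi //.
have [cx {}sx] := cosDD_N1 c1; have [cy {}sy] := cosDD_N1 c2.
case: sx => sx; case: sy => sy.
- apply: (conj Rep7 id _ _ KH_map_id) => //.
  by apply: eq_trot; rewrite ?cx ?cy ?sx ?sy ?cos_pihalf ?sin_pihalf.
- apply: (conj Rep7 f3 _ _ K3) => //; rewrite E3.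
  apply: eq_trot; rewrite addrC ?cosDpi ?sinDpi ?cosN ?sinN ?cx ?cy ?sx ?sy;
      rewrite ?opprK ?oppr0 ?cos_pihalf ?sin_pihalf //.
- apply: (conj Rep7 f2 _ _ K2) => //; rewrite E2.
  apply: eq_trot; rewrite ?cosN ?sinN ?cx ?cy ?sx ?sy;
      rewrite ?opprK ?oppr0 ?cos_pihalf ?sin_pihalf //.
- apply: (conj Rep7 f1 _ _ K1) => //; rewrite E1.
  apply: eq_trot; rewrite addrC ?cosDpi ?sinDpi ?cx ?cy ?sx ?sy;
      rewrite ?opprK ?oppr0 ?cos_pihalf ?sin_pihalf //.
Qed.

Lemma vspace_dim1 (V : {vspace Mpq R p q}) : \dim V = 1%N ->
  exists2 X, X != 0 & V = <[X]>%VS.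
Proof.
move=> dV; have V0 : vpick V != 0 by rewrite vpick0 -dimv_eq0 dV.
exists (vpick V) => //; apply/esym/eqP.
by rewrite eqEdim -memvE memv_pick dim_vline V0 dV.
Qed.

(** In the negative block without d+1 the product of two such matrices has only the intermediate
    index 0, so it is a rank-one product of their u; in the positive block without 0 the same holds
    for their v through d+1. *)
Lemma pminus_comm (A B : Mpq R p q) : pminus A -> pminus B -> A *m B = B *m A ->
  (forall j k : 'I_(p.+1 + q.+1), (p < j)%N -> j != iL -> (p < k)%N -> k != iL ->
     A io j * B io k = B io j * A io k) /\
  (forall i k : 'I_(p.+1 + q.+1), (i <= p)%N -> i != io -> (k <= p)%N -> k != io ->
     A i iL * B k iL = B i iL * A k iL).
Proof.
move=> pA pB /matrixP AB.
have mulu (X Y : Mpq R p q) (j k : 'I_(p.+1 + q.+1)) : pminus X -> pminus Y ->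
    (p < j)%N -> j != iL -> (X *m Y) j k = X io j * Y io k.
  move=> pX pY jp jL; rewrite mxE (bigD1 io) //= big1 ?addr0; last first.
    by move=> m m0; rewrite (pminus_neg pX) ?mul0r.
  by rewrite (pminus_sym j io).
have mulv (X Y : Mpq R p q) (i k : 'I_(p.+1 + q.+1)) : pminus X -> pminus Y ->
    (i <= p)%N -> i != io -> (X *m Y) i k = X i iL * Y k iL.
  move=> pX pY ip i0; rewrite mxE (bigD1 iL) //= big1 ?addr0; last first.
    by move=> m mL; rewrite (pminus_pos pX) ?mul0r.
  by rewrite (pminus_sym iL k).
split=> [j k jp jL kp kL|i k ip i0 kp k0].
  by have := AB j k; rewrite !mulu.
by have := AB i k; rewrite !mulv.
Qed.

(** One step of Gaussian elimination on proportional coordinate vectors; independence of [A] and [B]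
    keeps the result nonzero. The coordinates [c] are abstract so that it serves both for u and for
    v. *)
Lemma eliminate_coordinate (V : {vspace Mpq R p q}) (A B : Mpq R p q)
    (P : pred 'I_(p.+1 + q.+1)) (c : Mpq R p q -> 'I_(p.+1 + q.+1) -> R) :
  (forall k X Y j, c (X + k *: Y) j = c X j + k * c Y j) ->
  A \in V -> B \in V -> A != 0 -> B \notin <[A]>%VS ->
  (forall j k, P j -> P k -> c A j * c B k = c B j * c A k) ->
  exists X, [/\ X \in V, X != 0 & forall j, P j -> c X j = 0].
Proof.
move=> cD AV BV A0 BA AB.
have [[j [Pj Aj]]|no] := pselect (exists j, P j /\ c A j != 0); last first.
  exists A; split=> // j Pj; apply/eqP/negP => /negP nz.
  by apply: no; exists j.
exists (B + - (c B j / c A j) *: A); split.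
- by rewrite memvD // memvZ.
- apply: contraNneq BA => /eqP; rewrite scaleNr subr_eq0 => /eqP ->.
  by rewrite memvZ ?memv_line.
- move=> k Pk; rewrite cD; have := AB _ _ Pj Pk => e.
  by rewrite mulNr mulrAC -e mulrAC divff // mul1r subrr.
Qed.

Theorem standard_cartan_classification (C' : set (Mpq R p q)) :
  standard_cartan C' ->
  exists2 l, cartan_label_ok q l & cartan_conj C' (cartan_rep R p q l).
Proof.
move=> [T' CT]; have := CT.
move=> [t [c' [t' [a' [[tT cg ct cc cE cap tt _ ap dimc] C'E T'E]]]]].
have [x [y tE]] := TgrpP tT; move: T'E; rewrite tE => T'E.
have tc X : X \in t' -> X \in c' by rewrite cE; apply/subvP; exact: addvSl.
have ac X : X \in a' -> X \in c' by rewrite cE; apply/subvP; exact: addvSr.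
have pm X : X \in a' -> pminus X by move=> aX; split; [exact: ap|exact/cg/ac].
have tcomm X : X \in a' -> trot (x + x) (y + y) *m X = X *m trot (x + x) (y + y).
  move=> aX; apply/gminus_Ad_trot; first exact/cg/ac.
  by rewrite -tE; exact/ct/ac.
have dims : (\dim t' + \dim a' = 2)%N.
  by rewrite -(dimv_disjoint_sum cap) -cE dimc calgE dim_talg.
have : [\/ \dim t' = 2%N, \dim t' = 0%N | \dim t' = 1%N /\ \dim a' = 1%N].
  move: dims; case: (\dim t') => [|[|[|//]]] /= h; [by constructor 2| |by constructor 1].
  by constructor 3; split=> //; case: h.
case=> [dt|dt|[dt da]].
- exists Rep1 => //; apply: (cartan_conj_rep CT _ KH_map_id) => //.
  have -> : T' = exp_coset (talg R p q) (trot x y).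
    by rewrite T'E; congr exp_coset; apply/eqP; rewrite eqEdim tt dim_talg dt.
  by rewrite image_id exp_coset_talg.
- have t0 : t' = 0%VS by apply/eqP; rewrite -dimv_eq0 dt.
  have T'1 : T' = [set trot x y] by rewrite T'E t0 exp_coset0.
  have da : \dim a' = 2%N by rewrite -dims dt.
  have A0 : vpick a' != 0 by rewrite vpick0 -dimv_eq0 da.
  have Aa : vpick a' \in a' := memv_pick a'.
  have [B Ba BA] : exists2 B, B \in a' & B \notin <[vpick a']>%VS.
    by apply/subvPn/negP => /dimvS; rewrite da dim_vline A0.
  have [uAB vAB] := pminus_comm (pm _ Aa) (pm _ Ba) (cc _ _ (ac _ Aa) (ac _ Ba)).
  (* An element of [a'] with u = 0 must have v nonzero, and conversely; the two elements [Y] and [X]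
     constrain the two angles of the square of [t] separately. *)
  have [Y [Ya Y0 Yu]] : exists Y, [/\ Y \in a', Y != 0 &
      forall j : 'I_(p.+1 + q.+1), (p < j)%N && (j != iL) -> Y io j = 0].
    apply: (@eliminate_coordinate a' _ _ (fun j => (p < j)%N && (j != iL)) (fun X j => X io j)
      _ Aa Ba A0 BA).
      by move=> k X Y j; rewrite !mxE.
    by move=> j k /andP[jp jL] /andP[kp kL]; exact: uAB.
  have [X [Xa X0 Xv]] : exists X, [/\ X \in a', X != 0 &
      forall i : 'I_(p.+1 + q.+1), (i <= p)%N && (i != io) -> X i iL = 0].
    apply: (@eliminate_coordinate a' _ _ (fun i => (i <= p)%N && (i != io)) (fun X i => X i iL)
      _ Aa Ba A0 BA).
      by move=> k X Z j; rewrite !mxE.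
    by move=> j k /andP[jp jL] /andP[kp kL]; exact: vAB.
  have [X1 _ [X2 _ X3 X4]] := trot_comm (pm _ Xa) (tcomm _ Xa).
  have [_ Y1 [_ Y2 Y3 Y4]] := trot_comm (pm _ Ya) (tcomm _ Ya).
  have iD_out : (p < iD)%N && (iD != iL) by rewrite iD_neg iD_iL.
  have il_out : (il <= p)%N && (il != io) by rewrite il_pos eq_sym io_il.
  (* A nonzero entry of u away from d makes the square of [t] trivial on the first plane; otherwise
     the entry at d ties the two angles together. *)
  have hX : sin (x + x) = 0 /\
      (cos (x + x) = 1 \/ cos (x + x) = cos (y + y) /\ sin (y + y) = 0).
    have [[j [jp jL Xj]]|[i [ip i0 /eqP[]]]] := pminus_nonzero (pm _ Xa) X0; last first.
      by apply: Xv; rewrite ip.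
    have [e|jD] := eqVneq j iD; last by have [-> ->] := X1 j jp jD jL Xj; split; auto.
    move: X2 X3 X4 Xj; rewrite e (Xv _ il_out) !mulr0 oppr0 => X2 X3 X4 Xj.
    move/eqP: X2; rewrite mulf_eq0 (negPf Xj) orbF subr_eq0 => /eqP ->.
    move/eqP: X4; rewrite mulf_eq0 (negPf Xj) orbF => /eqP ->.
    move/esym/eqP: X3; rewrite oppr_eq0 mulf_eq0 (negPf Xj) orbF => /eqP ->.
    by split=> //; right.
  have hY : sin (y + y) = 0 /\ (cos (y + y) = 1 \/ cos (x + x) = cos (y + y)).
    have [[i [ip i0 /eqP[]]]|[j [jp jL Yj]]] := pminus_nonzero (pm _ Ya) Y0.
      by apply: Yu; rewrite ip.
    have [e|jl] := eqVneq j il; last by have [-> ->] := Y1 j jp jL jl Yj; split; auto.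
    move: Y2 Y4 Yj; rewrite e (Yu _ iD_out) !mulr0 => Y2 Y4 Yj.
    move/eqP: Y2; rewrite mulf_eq0 (negPf Yj) orbF subr_eq0 => /eqP ->.
    move/esym/eqP: Y4; rewrite oppr_eq0 mulf_eq0 (negPf Yj) orbF => /eqP ->.
    by split=> //; right.
  apply: (@conj_rep678 C' x y); rewrite -?T'1 //; [by case: hX|by case: hY|].
  by case: hX => _ [h1|[]//]; case: hY => _ [h2|//]; rewrite h1 h2.
have [S S0 t'E] := vspace_dim1 dt; have [A A0 a'E] := vspace_dim1 da.
have St : S \in t' by rewrite t'E memv_line.
have Aa : A \in a' by rewrite a'E memv_line.
have [k [m SE]] := talgP (subvP tt _ St).
have T'1 : T' = range (fun s => trot (s * k + x) (s * m + y)).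
  by rewrite T'E t'E SE exp_coset_torus_line.
have km0 : k = 0 -> m = 0 -> False.
  by move=> k0 m0; move: S0; rewrite SE k0 m0 !scale0r addr0 eqxx.
have := cc _ _ (tc _ St) (ac _ Aa); rewrite SE => SA.
have [S1 S2 S3 S4] := talg_comm (pm _ Aa) SA.
have [A1 A2 [A3 A4 A5 A6]] := trot_comm (pm _ Aa) (tcomm _ Aa).
have [[j [jp jD jL Aj]]|hu] := pselect
    (exists j : 'I_(p.+1 + q.+1), [/\ (p < j)%N, j != iD, j != iL & A io j != 0]).
  have k0 := S1 j jp jD jL Aj; have [_ c1] := A1 j jp jD jL Aj.
  have q1 : q <> 1%N.
    (* For q = 1 the only negative indices are d and d+1. *)
    move=> q1; have := ltn_ord j; move/eqP: jD; move/eqP: jL => jL jD jlt.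
    have [e|] := eqVneq (j : nat) iD; first by apply: jD; exact: val_inj.
    have [e|] := eqVneq (j : nat) iL; first by move=> _; apply: jL; exact: val_inj.
    by rewrite iDE iLE; lia.
  exists Rep5 => //; apply: (conj_rep5 CT q1 (k := m) (m := y) _ c1).
    by apply/eqP => m0; exact: km0.
  by rewrite T'1; apply: eq_range => s; rewrite k0 mulr0 add0r.
have [[i [ip i0 il' Ai]]|hv] := pselect
    (exists i : 'I_(p.+1 + q.+1), [/\ (i <= p)%N, i != io, i != il & A i iL != 0]).
  have m0 := S2 i ip i0 il' Ai; have [_ c1] := A2 i ip i0 il' Ai.
  exists Rep4 => //; apply: (conj_rep4 CT (k := k) (m := x) _ c1).
    by apply/eqP => k0; exact: km0.
  by rewrite T'1; apply: eq_range => s; rewrite m0 mulr0 add0r.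
have uv : A io iD != 0 \/ A il iL != 0.
  have [[j [jp jL Aj]]|[i [ip i0 Ai]]] := pminus_nonzero (pm _ Aa) A0.
    left; have [<-//|jD] := eqVneq j iD.
    by exfalso; apply: hu; exists j.
  right; have [<-//|il'] := eqVneq i il.
  by exfalso; apply: hv; exists i.
(* The two remaining entries of [A], not both zero, solve a homogeneous linear system with
   determinant k^2 - m^2. *)
have sq : k ^+ 2 = m ^+ 2.
  have h1 : (k ^+ 2 - m ^+ 2) * A il iL = 0.
    transitivity (k * (k * A il iL + m * A io iD) - m * (k * A io iD + m * A il iL)).
      by ring.
    by rewrite S3 S4 !addNr !mulr0 subr0.
  have h2 : (k ^+ 2 - m ^+ 2) * A io iD = 0.
    transitivity (k * (k * A io iD + m * A il iL) - m * (k * A il iL + m * A io iD)).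
      by ring.
    by rewrite S3 S4 !addNr !mulr0 subr0.
  apply/eqP; rewrite -subr_eq0; apply/eqP.
  case: uv => nz; apply: (mulIf nz); by rewrite mul0r.
have rep23 phi d : KH_map phi -> cos (d + d) = 1 ->
    phi @` T' = range (fun u => trot u (u + d)) ->
    exists2 l, cartan_label_ok q l & cartan_conj C' (cartan_rep R p q l).
  by move=> K h e; have [?|?] := conj_rep23 CT K h e; [exists Rep2|exists Rep3].
have cxy : cos (x + x) = cos (y + y).
  apply/eqP; rewrite -subr_eq0; apply/eqP.
  by case: uv => nz; apply: (mulIf nz); rewrite mul0r.
have cs := cos2Dsin2 (x + x).
have /orP[] : (k == m) || (k == - m) by rewrite -eqf_sqr sq.
- move=> /eqP km; have m0 : m != 0 by apply/eqP => m0; apply: km0; rewrite ?km.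
  have vu : A il iL = - A io iD.
    by apply: (mulfI m0); rewrite -{1}km S3 mulrN.
  have nz : A io iD != 0 by case: uv => //; rewrite vu oppr_eq0.
  have sxy : sin (x + x) = sin (y + y).
    by apply: (mulIf nz); move: A6; rewrite vu mulrN opprK.
  (* With the first angle as parameter, the line k = m has constant angle difference y - x. *)
  apply: (rep23 id (y - x) KH_map_id).
    rewrite (_ : _ + _ = (y + y) - (x + x)); last by ring.
    by rewrite cosB -cxy -sxy -!expr2.
  rewrite image_id T'1 -[RHS](range_affine _ x m0); apply: eq_range => s.
  by rewrite km; congr trot; ring.
move=> /eqP km; have m0 : m != 0.
  by apply/eqP => m0; apply: km0; rewrite ?km m0 ?oppr0.
have vu : A il iL = A io iD.
  by apply: (mulfI m0); move: S3; rewrite km mulNr => /oppr_inj.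
have nz : A io iD != 0 by case: uv => //; rewrite vu.
have sxy : sin (x + x) = - sin (y + y).
  by apply: (mulIf nz); move: A6; rewrite vu mulNr.
have [phi K phiE] := KH_map_flip.
(* Reversing the first angle turns the antidiagonal line into a diagonal one, with angle difference
   x + y. *)
apply: (rep23 phi (x + y) K).
  rewrite (_ : _ + _ = (x + x) + (y + y)); last by ring.
  have sxy' : sin (y + y) = - sin (x + x) by rewrite sxy opprK.
  by rewrite cosD -cxy sxy' mulrN opprK -!expr2.
rewrite T'1 image_comp -[RHS](range_affine _ (- x) m0); apply: eq_range => s.
by rewrite /= phiE km; congr trot; ring.
Qed.

End SpecialIndices.

Theorem corollary6p10 (R : realType) (p q : nat)
    (q_le_p : (q <= p)%N) (d_gt2 : (2 < p + q)%N) (q_gt0 : (0 < q)%N) :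
  [/\ forall l : cartan_label,
        standard_cartan (cartan_rep R p q l) <-> cartan_label_ok q l,
      forall C' : set (Mpq R p q), standard_cartan C' ->
        exists2 l : cartan_label, cartan_label_ok q l &
          cartan_conj C' (cartan_rep R p q l)
    & forall l1 l2 : cartan_label,
        cartan_label_ok q l1 -> cartan_label_ok q l2 ->
        cartan_conj (cartan_rep R p q l1) (cartan_rep R p q l2) -> l1 = l2].
Proof.
split.
- move=> l; split=> [|okl].
    by case: l => //; exact: cartan_rep5_exists.
  exists (torus_rep l); exact: torus_rep_pair.
- exact: standard_cartan_classification.
- exact: cartan_rep_conj_inj.
Qed.
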